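(* Let $n,N,k\in\mathbb N$, let $\Omega\subset\mathbb R^n$ be a bounded open set, and let $\mathrm H:\Omega\times\mathbb R^\Lambda\to[0,\infty)$ be a continuous function with $\mathrm H(x,0)=0$ for $x\in\Omega$, satisfying the following two conditions. (1) There is a continuous function $c:[0,1]\times[0,\infty)\to[0,\infty)$ with $c(1,\cdot)=c(\cdot,0)=0$ and $c>0$ on $(0,1)\times(0,\infty)$ such that $$\mathrm H(x,tX)\le \mathrm H(x,X)-c(t,|X|)\qquad \forall\, t\in[0,1],\ \forall\, X\in\mathbb R^\Lambda,\ \text{a.e. } x\in\Omega .$$ (2) For every $R>0$ there is a non-decreasing $\omega_R\in C(0,\infty)$ with $\omega_R(0^+)=0$ such that $$|\mathrm H(x,X)-\mathrm H(x,X')|\le \omega_R(|X-X'|)\qquad \text{a.e. } x\in\Omega,\ \forall\, X,X'\in\overline{\mathbb B}_R(0),\ X\neq X'.$$ Assume also that $\mathrm H(x,X_0,\dots,X_{k-1},\cdot)$ is convex on $\mathbb R^{Nn^k}$ (for all $x\in\Omega$ and all $(X_0,\dots,X_{k-1})$). Let $u_0\in W^{k,\infty}(\Omega,\mathbb R^N)$ be fixed. Then there exist infinitely many maps $u\in W^{k,\infty}_{u_0}(\Omega,\mathbb R^N)\cap\mathrm{AM}_c(\Omega,\mathbb R^N)$, i.e. absolute minimisers of $\mathrm E_\infty$ with respect to compactly supported variations, satisfying $u=u_0$ on $\partial\Omega$.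
   Context: Notation: $\mathbb R^\Lambda\cong\mathbb R^N\times\mathbb R^{Nn}\times\dots\times\mathbb R^{Nn^k}$, so $\Lambda=N(1+n+\dots+n^k)$, with elements $X=(X_0,X_1,\dots,X_k)$; $\overline{\mathbb B}_R(0)$ is the closed ball of radius $R$ centred at $0$ in $\mathbb R^\Lambda$ and $|\cdot|$ is the Euclidean norm. For $u\in W^{k,\infty}(\Omega,\mathbb R^N)$, the jet of order $k$ is $\mathrm D^{\vec k}u:=(u,\mathrm Du,\dots,\mathrm D^ku):\Omega\to\mathbb R^\Lambda$. The supremal functional is $$\mathrm E_\infty(u,U):=\operatorname*{ess\,sup}_{x\in U}\mathrm H\big(x,\mathrm D^{\vec k}u(x)\big),\qquad U\subseteq\Omega\text{ Lebesgue measurable}.$$ $W^{k,\infty}_c(U,\mathbb R^N)$ is the space of maps in $W^{k,\infty}(U,\mathbb R^N)$ with compact support in $U$. The class $\mathrm{AM}_c(\Omega,\mathbb R^N)$ consists of all $u\in W^{k,\infty}(\Omega,\mathbb R^N)$ such that $$\mathrm E_\infty(u,U)\le \mathrm E_\infty(u+\phi,U)\qquad\forall\,\phi\in W^{k,\infty}_c(U,\mathbb R^N),\ \forall\, U\subseteq\Omega\text{ open}.$$ $W^{k,\infty}_{u_0}(\Omega,\mathbb R^N):=u_0+W^{k,\infty}_0(\Omega,\mathbb R^N)$, where $W^{k,\infty}_0(\Omega,\mathbb R^N)=W^{k,\infty}(\Omega,\mathbb R^N)\cap W^{k,1}_0(\Omega,\mathbb R^N)$ is the space of $W^{k,\infty}$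 maps with zero boundary values. *)

(* Defs.v *)
From HB Require Import structures.
From mathcomp Require Import all_boot all_order all_algebra.
From mathcomp Require Import all_classical all_reals all_analysis.
Import Order.TTheory GRing.Theory Num.Theory.
Import numFieldNormedType.Exports.

Set Implicit Arguments.
Unset Strict Implicit.
Unset Printing Implicit Defensive.

Local Open Scope classical_set_scope.
Local Open Scope ring_scope.

Definition rV_display : measure_display. Proof. exact: default_measure_display. Qed.

Section rV_measurable.
Variables (R : realType) (n : nat).

Definition rV_coord (i : 'I_n) (x : 'rV[R]_n) : R := x ord0 i.

Let rV_set0 : g_sigma_preimage rV_coord set0.
Proof. exact: sigma_algebra0. Qed.

Let rV_setC A : g_sigma_preimage rV_coord A -> g_sigma_preimage rV_coord (~` A).
Proof. exact: sigma_algebraC. Qed.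

Let rV_bigcup (F : _^nat) : (forall i, g_sigma_preimage rV_coord (F i)) ->
  g_sigma_preimage rV_coord (\bigcup_i (F i)).
Proof. exact: sigma_algebra_bigcup. Qed.

HB.instance Definition _ := @isMeasurable.Build rV_display
  'rV[R]_n (g_sigma_preimage rV_coord) rV_set0 rV_setC rV_bigcup.

End rV_measurable.

Section rV_lebesgue.
Variable R : realType.
Local Open Scope ereal_scope.

Lemma measurable_rV_coord n (i : 'I_n) :
  measurable_fun [set: 'rV[R]_n] (@rV_coord R n i).
Proof.
move=> _ Y mY; rewrite setTI; apply: sub_sigma_algebra => /=.
rewrite -bigcup_seq/=; exists i => /=; first by rewrite mem_index_enum.
by exists Y => //; rewrite setTI.
Qed.

Lemma measurable_fun_rV d (T : measurableType d) n (f : T -> 'rV[R]_n) :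
  (forall i, measurable_fun [set: T] (@rV_coord R n i \o f)) ->
  measurable_fun [set: T] f.
Proof.
move=> mf.
have sub : g_sigma_preimage (fun i => @rV_coord R n i \o f) `<=` measurable.
  apply: smallest_sub; first exact: sigma_algebra_measurable.
  case: n f mf => [|n] f mf; first by rewrite big_ord0.
  rewrite -bigcup_mkord_ord; apply: bigcup_sub => i Ii.
  by move=> A [B mB <-]; exact: mf.
move=> _ A mA; apply: sub; rewrite g_sigma_preimage_comp.
by exists A.
Qed.

Definition rV_cons n (p : R * 'rV[R]_n) : 'rV[R]_n.+1 :=
  row_mx (p.1)%:M p.2 : 'rV[R]_(1 + n).

Definition rV_uncons n (x : 'rV[R]_n.+1) : R * 'rV[R]_n :=
  (x ord0 ord0, \row_j x ord0 (lift ord0 j)).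

Lemma rV_consE n t (y : 'rV[R]_n) : rV_coord ord0 (rV_cons (t, y)) = t /\
  forall j, rV_coord (lift ord0 j) (rV_cons (t, y)) = y ord0 j.
Proof.
rewrite /rV_coord /rV_cons/=; split=> [|j].
  have -> : (ord0 : 'I_n.+1) = lshift n (ord0 : 'I_1) by exact: val_inj.
  by rewrite (row_mxEl t%:M y) mxE eqxx.
have -> : lift ord0 j = rshift 1 j by exact: val_inj.
exact: (row_mxEr (t%:M : 'M[R]_1) y).
Qed.

Lemma rV_uncons_consK n : cancel (@rV_uncons n) (@rV_cons n).
Proof.
move=> x; apply/rowP => i; have [x0 xj] := rV_consE (x ord0 ord0) (rV_uncons x).2.
case: (unliftP ord0 i) => [j ->|->]; last exact: x0.
by rewrite -[LHS]/(rV_coord _ _) xj mxE.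
Qed.

Lemma rV_consK n : cancel (@rV_cons n) (@rV_uncons n).
Proof.
move=> [t y]; have [x0 xj] := rV_consE t y.
rewrite /rV_uncons; congr pair; first exact: x0.
by apply/rowP => j; rewrite mxE; exact: xj.
Qed.

Lemma measurable_rV_cons n : measurable_fun setT (@rV_cons n).
Proof.
apply: measurable_fun_rV => i; case: (unliftP ord0 i) => [j ->|->].
  rewrite (_ : _ \o _ = @rV_coord R n j \o snd); last first.
    by apply/funext => -[t y]; exact: (rV_consE t y).2.
  by apply: measurableT_comp => //; exact: measurable_rV_coord.
rewrite (_ : _ \o _ = fst) //.
by apply/funext => -[t y]; exact: (rV_consE t y).1.
Qed.

Lemma measurable_rV_uncons n : measurable_fun setT (@rV_uncons n).
Proof.
apply: measurable_fun_pair; first exact: measurable_rV_coord.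
apply: measurable_fun_rV => i; rewrite (_ : _ \o _ = rV_coord (lift ord0 i)).
  exact: measurable_rV_coord.
by apply/funext => x; rewrite /rV_coord/= mxE.
Qed.

Section step.
Variables (n : nat) (mu : {sigma_finite_measure set 'rV[R]_n -> \bar R}).

Definition lebesgue_rV_step : set 'rV[R]_n.+1 -> \bar R :=
  pushforward (lebesgue_measure \x mu) (@rV_cons n).

HB.instance Definition _ := Measure.copy lebesgue_rV_step
  (measure_function_pushforward__canonical__measure_function_Measure
     (lebesgue_measure \x mu) (@measurable_rV_cons n)).

Let lebesgue_rV_step_sigma_finite : sigma_finite setT lebesgue_rV_step.
Proof.
have [F FT Foo] : sigma_finite setT (@lebesgue_measure R \x mu).
  have /sigma_finiteP[F [TF ndF Foo]] := sigma_finiteT (@lebesgue_measure R).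
  have /sigma_finiteP[G [TG ndG Goo]] := sigma_finiteT mu.
  exists (fun i => F i `*` G i).
    rewrite -setXTT TF TG predeqE => -[x y]; split=> [|[i _ []]].
      move=> [/= [i _ Fx] [j _ Gy]]; exists (maxn i j) => //; split.
        by move: x Fx; exact/subsetPset/ndF/leq_maxl.
      by move: y Gy; exact/subsetPset/ndG/leq_maxr.
    by split; exists i.
  move=> i; have [? ?] := Foo i; have [? ?] := Goo i.
  split; first exact: measurableX.
  by rewrite product_measure1E// lte_mul_pinfty// ge0_fin_numE.
exists (fun i => @rV_uncons n @^-1` F i).
  by rewrite -preimage_bigcup -FT preimage_setT.
move=> i; have [mF muF] := Foo i; split.
  by rewrite -[X in measurable X]setTI; exact: measurable_rV_uncons.
rewrite /lebesgue_rV_step /pushforward -comp_preimage.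
by rewrite (_ : _ \o _ = idfun)//; apply/funext => p; exact: rV_consK.
Qed.

HB.instance Definition _ := Measure_isSigmaFinite.Build _ _ _
  lebesgue_rV_step lebesgue_rV_step_sigma_finite.

End step.

(* Lebesgue measure on the Borel sets of R^n. Its completion is not needed:
   negligible sets are the same, and every class of Lebesgue measurable
   functions modulo a.e. equality has a Borel measurable representative. *)
Fixpoint lebesgue_rV n : {sigma_finite_measure set 'rV[R]_n -> \bar R} :=
  if n is m.+1 then lebesgue_rV_step (lebesgue_rV m) else dirac (const_mx 0%R : 'rV[R]_0).

Lemma lebesgue_rV_box n (a b : 'rV[R]_n) :
  (forall i, a ord0 i <= b ord0 i)%R ->
  lebesgue_rV n [set x | forall i, x ord0 i \in `[a ord0 i, b ord0 i]%R] =
  (\prod_(i < n) (b ord0 i - a ord0 i))%:E.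
Proof.
elim: n a b => [|n IHn] a b ab.
  rewrite big_ord0 /= /dirac indicE mem_set// => -[]//.
rewrite big_ord_recl /= /lebesgue_rV_step /pushforward.
rewrite (_ : _ @^-1` _ = `[a ord0 ord0, b ord0 ord0]%classic `*`
  [set y : 'rV[R]_n | forall i, y ord0 i \in `[(rV_uncons a).2 ord0 i, (rV_uncons b).2 ord0 i]%R]).
  rewrite product_measure1E//=; last first.
    rewrite (_ : mkset _ = \bigcap_(i in setT) (rV_coord i @^-1`
      `[(rV_uncons a).2 ord0 i, (rV_uncons b).2 ord0 i]%classic)).
      apply: fin_bigcap_measurable => // i _.
      by rewrite -[X in measurable X]setTI; exact: measurable_rV_coord.
    by apply/seteqP; split=> [y yab i _|y yab i]; [exact: yab|exact: yab].
  rewrite IHn; last by move=> i; rewrite !mxE.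
  rewrite lebesgue_measure_itv/= lte_fin.
  under [X in _ * X%:E = _]eq_bigr do rewrite !mxE.
  rewrite EFinM; congr (_ * _).
  case: ltP => //; rewrite le_eqVlt ltNge ab orbF => /eqP ->.
  by rewrite subrr.
apply/seteqP; split=> -[t y]/=; have [x0 xj] := rV_consE t y.
- move=> H; split; first by have := H ord0; rewrite [X in X \in _]x0.
  by move=> j; have := H (lift ord0 j); rewrite [X in X \in _]xj !mxE.
- move=> [tab yab] i; case: (unliftP ord0 i) => [j ->|->].
    by have := yab j; rewrite [X in _ -> X \in _]xj !mxE.
  by rewrite [X in X \in _]x0.
Qed.

End rV_lebesgue.

Section test_functions.
Variables (R : realType) (n : nat).
Implicit Types (Omega : set 'rV[R]_n) (f : 'rV[R]_n -> R) (s : seq 'I_n).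

Definition pderiv s f : 'rV[R]_n -> R :=
  foldr (fun i g x => 'D_(delta_mx ord0 i) g x) f s.

Definition smooth f := forall s, continuous (pderiv s f) /\
  forall x i, derivable (pderiv s f) x (delta_mx ord0 i).

Definition test_function Omega f := [/\ smooth f,
  compact (closure [set x | f x != 0]) & closure [set x | f x != 0] `<=` Omega].

End test_functions.

Section weak_derivatives.
Variables (R : realType) (n : nat) (Omega : set 'rV[R]_n).
Implicit Types (f g : 'rV[R]_n -> R) (s : seq 'I_n).
Local Notation mu := (lebesgue_rV R n).

Definition locally_L1 f := measurable_fun Omega f /\
  forall K, compact K -> K `<=` Omega -> mu.-integrable K (EFin \o f).

Definition is_weak_deriv s f g := [/\ locally_L1 f, locally_L1 g &
  forall phi, test_function Omega phi ->
    \int[mu]_(x in Omega) (f x * pderiv s phi x) =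
    (-1) ^+ size s * \int[mu]_(x in Omega) (g x * phi x)].

(* A representative of the a.e.-unique weak derivative; the junk value [cst 0]
   is only used when [f] has no weak derivative along [s]. *)
Definition weak_deriv s f : 'rV[R]_n -> R :=
  xget (cst 0) [set g | is_weak_deriv s f g].

(* [f \_ Omega] vanishes outside Omega, so this is Borel measurability on Omega
   and finiteness of the L^p norm over Omega. *)
Definition memLp (p : \bar R) f := f \_ Omega \in Lfun mu p.

End weak_derivatives.

Section jets.
Variables (R : realType) (n N k : nat).

(* (j, (a, s)) indexes D_{s_1} ... D_{s_j} u_a, so that the order-j slots form
   R^(N n^j), the symmetry of derivatives being disregarded. *)
Definition jet_index := {j : 'I_k.+1 & ('I_N * j.-tuple 'I_n)%type}.

Definition jet_space := 'rV[R]_#|{: jet_index}|.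

Lemma card_jet_index : #|{: jet_index}| = (N * \sum_(j < k.+1) n ^ j)%N.
Proof.
rewrite card_tagged sumnE big_map big_enum/= big_distrr/=.
by apply: eq_bigr => j _; rewrite card_prod card_tuple !card_ord.
Qed.

(* Euclidean, unlike the max norm [`|X|] on row vectors. *)
Definition jet_norm (X : jet_space) : R :=
  Num.sqrt (\sum_i X ord0 i ^+ 2).

(* The affine slice {X_0} x ... x {X_(k-1)} x R^(N n^k); convexity of H(x, .) on
   all slices is convexity of H in the highest-order variable. *)
Definition same_lower_order (X : jet_space) : set jet_space :=
  [set Y | forall i : jet_index, (tag i < k)%N ->
    Y ord0 (enum_rank i) = X ord0 (enum_rank i)].

End jets.

Section sobolev.
Variables (R : realType) (n N k : nat).
Implicit Types (Omega U : set 'rV[R]_n) (u phi : 'rV[R]_n -> 'rV[R]_N).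
Local Notation mu := (lebesgue_rV R n).
Local Notation J := (jet_index n N k).

Definition jet Omega u (x : 'rV[R]_n) : jet_space R n N k :=
  \row_i let a : J := enum_val i in
    weak_deriv Omega (tagged a).2 (fun y => u y ord0 (tagged a).1) x.

Definition sobolev (p : \bar R) Omega u :=
  (forall a, memLp Omega p (fun x => u x ord0 a)) /\
  forall i : J, exists2 g, memLp Omega p g &
    is_weak_deriv Omega (tagged i).2 (fun x => u x ord0 (tagged i).1) g.

Definition sobolev_norm (p : \bar R) Omega u : \bar R :=
  (\sum_i 'N[mu]_p[EFin \o ((fun x => jet Omega u x ord0 i) \_ Omega)])%E.

(* Closure of C_c^oo(Omega; R^N) in W^{k,1}(Omega; R^N). *)
Definition sobolev10 Omega u := sobolev 1%E Omega u /\
  forall e : R, 0 < e -> exists phi : 'rV[R]_n -> 'rV[R]_N,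
    (forall a, test_function Omega (fun x => phi x ord0 a)) /\
    (sobolev_norm 1 Omega (u \- phi)%R < e%:E)%E.

Definition sobolevoo0 Omega u := sobolev +oo%E Omega u /\ sobolev10 Omega u.

Definition sobolevoo_bc Omega (u0 : 'rV[R]_n -> 'rV[R]_N) :=
  [set u | sobolevoo0 Omega (u \- u0)].

(* The elements of W^{k,oo}_c(U) are identified with their extensions by 0. *)
Definition sobolevoo_c U phi := sobolev +oo%E U phi /\
  exists K, [/\ compact K, K `<=` U & forall x, ~ K x -> phi x = 0].

(* The essential supremum over U, for u a Sobolev map on Omega. *)
Definition E_sup (H : 'rV[R]_n -> jet_space R n N k -> R) Omega u U : \bar R :=
  ereal_inf [set y | \forall x \ae mu,
                       U x -> ((H x (jet Omega u x))%:E <= y)%E].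

Definition AM_c (H : 'rV[R]_n -> jet_space R n N k -> R) Omega :=
  [set u | sobolev +oo%E Omega u /\
    forall U, open U -> U `<=` Omega -> forall phi, sobolevoo_c U phi ->
      (E_sup H Omega u U <= E_sup H Omega (u \+ phi)%R U)%E].

(* The element of the Lebesgue or Sobolev space represented by u. *)
Definition ae_class Omega u :=
  [set v | \forall x \ae mu, Omega x -> v x = u x].

End sobolev.

(* Main.v *)
From HB Require Import structures.
Require Import Defs.
From mathcomp Require Import all_boot all_order all_algebra.
From mathcomp Require Import all_classical all_reals all_analysis measurable_realfun.
From mathcomp Require Import ring lra.
Import Order.TTheory GRing.Theory Num.Theory.
Import numFieldNormedType.Exports.

Set Implicit Arguments.
Unset Strict Implicit.
Unset Printing Implicit Defensive.

Local Open Scope classical_set_scope.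
Local Open Scope ring_scope.

(** The variations have compact support in [U], so each of them leaves an open
    part [U `\` K] of [U] untouched. Hence a map [u] is an absolute minimiser as
    soon as its energy density [H x (jet u x)] has one and the same essential
    supremum [C] over all nonempty open subsets of [Omega], see
    [saturated_AM_c]: the variation cannot lower the supremum over the untouched
    part, which is already [C]. Different levels [C] give different maps, and
    every large level is attained by a map with the boundary values of [u0]
    ([exists_saturated]), whence infinitely many minimisers.

    To reach a level [C] above the energy of [u0], one adds to [u0] a series of
    smooth bumps of one component, supported in cubes [Q m] that visit every open
    subset of [Omega] infinitely often. The [m]-th bump is amplified in small
    steps until the density first exceeds [C - eta m] somewhere in [Q m]
    ([raise_energy]). Three facts about [H], uniform in [x], make this work. By
    uniform continuity on bounded sets of jets, small steps overshoot by little,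
    so that the density stays below [C]. By coercivity ([H_coercive]), a bump of
    large amplitude does exceed the level, and densities below [C] keep the jets
    bounded as long as their lower-order parts are bounded. The lower-order parts
    are under control because the top-order derivatives of a bump of given
    amplitude do not depend on the size of the cube, while the lower-order ones
    tend to zero with it ([bump_family]).

    If the cubes shrink fast enough, almost every point lies in finitely many of
    them: jets are eventually stationary, so no compactness or semicontinuity is
    needed to pass to the limit. Moreover the set where step [m] came close to
    [C] is not negligible, and the total measure of the later cubes can be kept
    too small to cover it ([jet_lim_persistent]). The limit map thus has essential
    supremum [C] over every open set, and it has the boundary values of [u0] since
    it differs from the [m]-th stage on a set of vanishing measure with bounded
    jets ([u_lim_boundary]).

    Jets are only defined through a choice of weak derivatives. Their uniqueness
    and locality come from the fundamental lemma of the calculus of variations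
    ([fundamental_lemma]); the weak derivatives of smooth functions come from the
    translation invariance of Lebesgue measure ([integral_derive]). *)

(** * Boxes, cubes and Borel sets of row vectors *)

Section boxes.
Variables (R : realType) (n : nat).
Implicit Types (a b q x : 'rV[R]_n) (U : set 'rV[R]_n).

Lemma ler_coord_norm x i : `|x ord0 i| <= `|x|.
Proof.
rewrite [leRHS]/Num.Def.normr/= mx_normrE.
by rewrite (le_bigmax _ (fun ij : 'I_1 * 'I_n => `|x ij.1 ij.2|) (ord0, i)).
Qed.

Lemma rV_norm_le x (e : R) : 0 <= e -> (forall i, `|x ord0 i| <= e) -> `|x| <= e.
Proof.
move=> e0 xe; rewrite /Num.Def.normr/= mx_normrE.
by apply/bigmax_leP; split=> // -[i j] _ /=; rewrite (ord1 i).
Qed.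

Definition box a b : set 'rV[R]_n :=
  [set x | forall i, x ord0 i \in `[a ord0 i, b ord0 i]%R].

Definition cube q (e : R) : set 'rV[R]_n := [set x | `|x - q| <= e].

Lemma cube_box q e : 0 <= e -> cube q e = box (q - const_mx e) (q + const_mx e).
Proof.
move=> e0; apply/seteqP; split=> [x /= xq i|x /= xb].
  rewrite in_itv/= !mxE; have := le_trans (ler_coord_norm (x - q) i) xq.
  by rewrite !mxE ler_norml; lra.
apply: rV_norm_le => // i; have := xb i.
by rewrite in_itv/= !mxE ler_norml; lra.
Qed.

Lemma compact_box a b : compact (box a b).
Proof.
apply: (@rV_compact R n (fun i => `[a ord0 i, b ord0 i]%classic)) => i.
exact: segment_compact.
Qed.

Lemma measurable_box a b : measurable (box a b).
Proof.
rewrite (_ : box a b = \bigcap_(i in setT) (rV_coord i @^-1`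
    `[a ord0 i, b ord0 i]%classic)).
  apply: fin_bigcap_measurable => // i _.
  by rewrite -[X in measurable X]setTI; exact: measurable_rV_coord.
by apply/seteqP; split=> [y yab i _|y yab i]; [exact: yab|exact: yab].
Qed.

Lemma compact_cube q e : compact (cube q e).
Proof.
have [e0|e0] := leP 0 e; first by rewrite cube_box//; exact: compact_box.
rewrite (_ : cube q e = set0); first exact: compact0.
by rewrite -subset0 => x /= /(le_trans (normr_ge0 _)); rewrite leNgt e0.
Qed.

Lemma measurable_cube q e : measurable (cube q e).
Proof.
have [e0|e0] := leP 0 e; first by rewrite cube_box//; exact: measurable_box.
rewrite (_ : cube q e = set0) //.
by rewrite -subset0 => x /= /(le_trans (normr_ge0 _)); rewrite leNgt e0.
Qed.

(** The doubled cube inside [U] leaves room around the small one for functions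
    approximating its indicator. *)
Lemma open_rat_cube U x : open U -> U x ->
  exists j0 : nat, forall j, (j0 <= j)%N -> exists q : 'rV[rat]_n,
    cube (map_mx ratr q) j.+1%:R^-1 x /\
    cube (map_mx ratr q) (j.+1%:R^-1 *+ 2) `<=` U.
Proof.
move=> oU Ux; have /nbhs_ballP [e /= e0 eU] : nbhs x U by exact: open_nbhs_nbhs.
have [j0 _ hj0] : \forall j \near \oo, (j.+1%:R^-1 : R) < e / 4.
  by apply: (near_infty_natSinv_lt (PosNum (divr_gt0 e0 (ltr0Sn _ 3)))).
exists j0 => j /hj0 je.
have : 0 < j.+1%:R^-1 :> R by rewrite invr_gt0 ltr0n.
move: je; set d := (j.+1%:R^-1 : R) => je d0.
have /choice [q hq] : forall i, exists r : rat,
    x ord0 i - d < ratr r < x ord0 i + d.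
  move=> i; have [|r] := @rat_in_itvoo R (x ord0 i - d) (x ord0 i + d).
    by lra.
  by rewrite in_itv/= => ?; exists r.
exists (\row_i q i); split.
  apply: rV_norm_le => [|i]; first exact: ltW.
  by rewrite !mxE ler_norml; have := hq i; lra.
move=> y yq; apply: eU; rewrite -ball_normE/=.
rewrite (@le_lt_trans _ _ (d + d *+ 2))//; last by lra.
apply: rV_norm_le => [|i]; first lra.
have := le_trans (ler_coord_norm _ i) yq; rewrite !mxE !ler_norml => ?.
by have := hq i; lra.
Qed.

Lemma cube_subset q (e e' : R) : e <= e' -> cube q e `<=` cube q e'.
Proof. by move=> ee' x /le_trans; exact. Qed.

Lemma open_measurable_rV U : open U -> measurable U.
Proof.
move=> oU; pose P (z : 'rV[rat]_n * nat) := cube (map_mx ratr z.1) z.2.+1%:R^-1 `<=` U.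
rewrite (_ : U = \bigcup_(z in P) cube (map_mx ratr z.1) z.2.+1%:R^-1).
  rewrite bigcup_mkcond; apply: countable_bigcupT_measurable => // z.
  by case: ifP => // _; exact: measurable_cube.
apply/seteqP; split=> [x Ux|x [z Pz]]; last exact: Pz.
have [j0 /(_ _ (leqnn _)) [q [qx qU]]] := open_rat_cube oU Ux.
exists (q, j0) => //; apply: subset_trans qU; apply: cube_subset => /=.
by rewrite mulr2n lerDl invr_ge0.
Qed.

Lemma continuous_measurable_rV (f : 'rV[R]_n -> R) :
  continuous f -> measurable_fun setT f.
Proof.
move=> cf; apply: (measurability _ (RGenOInfty.measurableE R)).
move=> _ [_ [t ->] <-]; rewrite setTI; apply: open_measurable_rV.
by apply: open_comp => [x _|]; [exact: cf|exact: interval_open].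
Qed.

Lemma boxI a b a' b' : box a b `&` box a' b' =
  box (\row_i Num.max (a ord0 i) (a' ord0 i)) (\row_i Num.min (b ord0 i) (b' ord0 i)).
Proof.
apply/seteqP; split=> [x [xb xb'] i|x xb].
  rewrite in_itv/= !mxE ge_max le_min.
  have := xb i; have := xb' i; rewrite !in_itv/=.
  by move=> /andP[-> ->] /andP[-> ->].
split=> i; have := xb i; rewrite !in_itv/= !mxE ge_max le_min.
  by move=> /andP[/andP[-> _] /andP[-> _]].
by move=> /andP[/andP[_ ->] /andP[_ ->]].
Qed.

Lemma measurable_rV_boxE :
  @measurable _ 'rV[R]_n = <<s [set A | exists a b, A = box a b] >>.
Proof.
set G := [set A | _]; apply/seteqP; split; last first.
  apply: smallest_sub; first exact: sigma_algebra_measurable.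
  by move=> _ [a [b ->]]; exact: measurable_box.
apply: smallest_sub; first exact: smallest_sigma_algebra.
rewrite -bigcup_seq; apply: bigcup_sub => i _ A [Y mY <-]; rewrite setTI.
suff : measurable `<=` [set Y | <<s G >> (@rV_coord R n i @^-1` Y)].
  by apply.
rewrite [X in X `<=` _]RGenCInfty.measurableE; apply: smallest_sub.
  split=> /=.
  - by rewrite preimage_set0; exact: sigma_algebra0.
  - move=> B GB; rewrite setTD preimage_setC -setTD.
    exact: sigma_algebraCD.
  - by move=> B GB; rewrite preimage_bigcup; exact: sigma_algebra_bigcup.
move=> _ [t ->] /=; set S := _ @^-1` _.
have -> : S = \bigcup_k
    box (\row_j if j == i then t else - k%:R) (const_mx k%:R).
  apply/seteqP; split=> [x /= |x [k _ /(_ i)]]; last first.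
    by rewrite /S/= !in_itv/= !mxE eqxx andbT => /andP[].
  rewrite /S/= in_itv/= andbT => tx.
  exists (Num.bound `|x|) => // j; rewrite in_itv/= !mxE.
  have := le_lt_trans (ler_coord_norm x j) (archi_boundP (normr_ge0 x)).
  rewrite ltr_norml => /andP[x1 x2]; rewrite (ltW x2) andbT.
  by case: eqP => [->//|_]; exact: ltW.
apply: sigma_algebra_bigcup => k; apply: sub_sigma_algebra.
by do 2 eexists.
Qed.

Lemma box_cover : \bigcup_k box (const_mx (- k%:R)) (const_mx k%:R) = setT.
Proof.
apply/seteqP; split=> // x _; exists (Num.bound `|x|) => // j.
rewrite in_itv/= !mxE.
have := le_lt_trans (ler_coord_norm x j) (archi_boundP (normr_ge0 x)).
by rewrite ltr_norml => /andP[/ltW-> /ltW->].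
Qed.

(** Boxes are stable under intersection and generate the Borel sets. *)
Lemma measure_box_unique (m1 m2 : {measure set 'rV[R]_n -> \bar R}) :
  (forall a b, (m1 (box a b) < +oo)%E) ->
  (forall a b, m1 (box a b) = m2 (box a b)) ->
  forall A, measurable A -> m1 A = m2 A.
Proof.
move=> m1oo m12 A mA.
apply: (measure_unique [set A | exists a b, A = box a b]
   (fun k => box (const_mx (- k%:R)) (const_mx k%:R))) => //.
- exact: measurable_rV_boxE.
- by move=> _ _ [a [b ->]] [a' [b' ->]]; rewrite boxI; do 2 eexists.
- by move=> k; do 2 eexists.
- exact: box_cover.
- by move=> _ [a [b ->]]; exact: m12.
Qed.

End boxes.

(** * Lebesgue measure of cubes, open sets and translates *)

Section lebesgue_facts.
Variables (R : realType) (n : nat).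
Local Notation mu := (lebesgue_rV R n).
Implicit Types (a b q x : 'rV[R]_n) (U : set 'rV[R]_n).

Lemma lebesgue_box a b : mu (box a b) =
  (\prod_(i < n) Num.max 0 (b ord0 i - a ord0 i))%:E.
Proof.
have [ab|] := pselect (forall i, a ord0 i <= b ord0 i).
  rewrite lebesgue_rV_box//; congr EFin; apply: eq_bigr => i _.
  by rewrite max_r// subr_ge0.
move=> /existsNP [i /negP]; rewrite -ltNge => ba.
rewrite (_ : box a b = set0) ?measure0; last first.
  rewrite -subset0 => x /(_ i); rewrite in_itv/= => /andP[ax xb].
  by have := le_trans ax xb; rewrite leNgt ba.
by rewrite (bigD1 i)//= max_l ?mul0r// subr_le0 ltW.
Qed.

Lemma lebesgue_box_fin a b : (mu (box a b) < +oo)%E.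
Proof. by rewrite lebesgue_box ltry. Qed.

Lemma lebesgue_cube q e : 0 <= e -> mu (cube q e) = ((e *+ 2) ^+ n)%:E.
Proof.
move=> e0; rewrite cube_box// lebesgue_box.
rewrite (eq_bigr (fun=> e *+ 2)) ?prodr_const ?card_ord// => i _.
by rewrite !mxE max_r; lra.
Qed.

Lemma open_not_negligible U : open U -> U !=set0 -> ~ mu.-negligible U.
Proof.
move=> oU [x Ux] nU.
have [j0 /(_ _ (leqnn _)) [q [_ qU]]] := open_rat_cube oU Ux.
have j1 : 0 < j0.+1%:R^-1 :> R by rewrite invr_gt0 ltr0n.
have /negligibleP : mu.-negligible (cube (map_mx ratr q) j0.+1%:R^-1).
  apply: negligibleS nU; apply: subset_trans qU; apply: cube_subset.
  by rewrite mulr2n lerDl ltW.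
move=> /(_ (measurable_cube _ _)) muC0.
have := lebesgue_cube (map_mx ratr q) (ltW j1).
rewrite [LHS]muC0 => -[] /esym/eqP.
by rewrite expf_eq0 mulrn_eq0 (gt_eqF j1) andbF.
Qed.

Lemma lebesgue_rV_shift a A : measurable A -> mu ((fun x => x + a) @^-1` A) = mu A.
Proof.
have mshift : measurable_fun setT (fun x : 'rV[R]_n => x + a).
  apply: measurable_fun_rV => i.
  rewrite (_ : _ \o _ = fun x => rV_coord i x + a ord0 i); last first.
    by apply/funext => x; rewrite /rV_coord/= mxE.
  by apply: measurable_funD => //; exact: measurable_rV_coord.
have boxE b c : (fun x => x + a) @^-1` box b c = box (b - a) (c - a).
  apply/seteqP; split=> x /= xb i; have := xb i; rewrite !in_itv/= !mxE; lra.
pose m' := measure_function_pushforward__canonical__measure_function_Measure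
  mu mshift.
move=> mA; apply/esym; apply: (@measure_box_unique _ _ mu m') => //.
  by move=> b c; exact: lebesgue_box_fin.
move=> b c; rewrite [RHS](_ : _ = mu ((fun x => x + a) @^-1` box b c)) // boxE.
rewrite [RHS]lebesgue_box; apply: (etrans (lebesgue_box b c)).
congr EFin; apply: eq_bigr => i _; rewrite !mxE.
by congr Num.max; lra.
Qed.

(** Positivity of the outer measure, in a form that does not require [A] to be
    measurable: [A] will be a set of points where the energy density is large,
    and nothing makes the density measurable. If removing sets of arbitrarily
    small measure could make [A] negligible, [A] would be covered by a negligible
    set and by an intersection of measure zero. *)
Lemma not_negligible_outer (A : set 'rV[R]_n) : ~ mu.-negligible A ->
  exists2 e : R, 0 < e &
    forall Z, measurable Z -> (mu Z <= e%:E)%E -> ~ mu.-negligible (A `\` Z).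
Proof.
move=> nA; apply: contrapT => /forall2NP H; apply: nA.
have /choice [Z HZ] : forall j : nat, exists Z, [/\ measurable Z,
    (mu Z <= (j.+1%:R^-1)%:E)%E & mu.-negligible (A `\` Z)].
  move=> j; have [|/existsNP [Z /not_implyP [mZ]]] := H j.+1%:R^-1.
    by rewrite invr_gt0 ltr0n.
  by move=> /not_implyP [Zj /contrapT]; exists Z.
have mIZ : measurable (\bigcap_j Z j).
  by apply: bigcapT_measurable => j; have [] := HZ j.
apply: (@negligibleS _ _ _ _ ((\bigcup_j (A `\` Z j)) `|` \bigcap_j Z j)).
  move=> x Ax; have [|/existsNP [j]] := pselect (forall j, Z j x).
    by right => j _.
  by left; exists j.
apply: negligibleU; first by apply: negligible_bigcup => j; have [] := HZ j.
apply/negligibleP => //; apply/eqP; rewrite eq_le measure_ge0 andbT.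
apply/lee_addgt0Pr => e e0; rewrite add0e.
have [j0 _ /(_ _ (leqnn _)) hj0] : \forall j \near \oo, (j.+1%:R^-1 : R) < e.
  exact: (near_infty_natSinv_lt (PosNum e0)).
have [mZ Zj _] := HZ j0.
apply: (@le_trans _ _ (mu (Z j0))); last first.
  by apply: (le_trans Zj); rewrite lee_fin ltW.
by apply: le_measure; rewrite ?inE//; exact: bigcap_inf.
Qed.

(** A violation at one point would persist on a neighbourhood, and nonempty open
    sets are not negligible. *)
Lemma ae_on_open (U : set 'rV[R]_n) (f : 'rV[R]_n -> R) (y : R) :
  open U -> {within U, continuous f} ->
  {ae mu, forall x, U x -> f x <= y} -> forall x, U x -> f x <= y.
Proof.
move=> oU cf [N [mN N0 fN]] x Ux; rewrite leNgt; apply/negP => yx.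
have oV : open (U `&` f @^-1` `]y, +oo[%classic).
  move: cf; rewrite continuous_open_subspace// => /(continuous_inP f oU); apply.
  exact: interval_open.
apply: (open_not_negligible oV).
  by exists x; split => //=; rewrite in_itv/= yx.
exists N; split => // z [Uz /=]; rewrite in_itv/= andbT => yz.
by apply: fN => /= /(_ Uz); rewrite leNgt yz.
Qed.

End lebesgue_facts.

(** * A flat function *)

Section flat.
Variable R : realType.
Implicit Types (t : R) (m : nat).

(** [flat 0] is the standard smooth function vanishing on the negative half-line;
    the powers of [t^-1] make the family stable under derivation, up to linear
    combinations. *)
Definition flat m t : R := if 0 < t then t^-1 ^+ m * expR (- t^-1) else 0.

Lemma flat_ge0 m t : 0 <= flat m t.
Proof.
rewrite /flat; case: ifP => // t0.
by rewrite mulr_ge0 ?expR_ge0// exprn_ge0// invr_ge0 ltW.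
Qed.

Lemma flat_npos m t : t <= 0 -> flat m t = 0.
Proof. by rewrite leNgt /flat => /negbTE ->. Qed.

Lemma flat_gt0 m t : 0 < t -> 0 < flat m t.
Proof. by move=> t0; rewrite /flat t0 mulr_gt0 ?expR_gt0// exprn_gt0 ?invr_gt0. Qed.

Lemma flat0_le1 t : flat 0 t <= 1.
Proof.
rewrite /flat; case: ifP => // t0.
by rewrite expr0 mul1r expR_le1 oppr_le0 invr_ge0 ltW.
Qed.

Lemma flat_le_norm m t : flat m t <= m.+1`!%:R * `|t|.
Proof.
have [t0|t0] := leP t 0; first by rewrite flat_npos// mulr_ge0.
rewrite /flat t0 expRN ler_pdivrMr ?expR_gt0// gtr0_norm// mulrAC.
have y0 : 0 <= t^-1 by rewrite invr_ge0 ltW.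
have H := expR_ge1Dxn m y0; rewrite -ler_pdivrMr//.
have -> : t^-1 ^+ m / t = t^-1 ^+ m.+1 by rewrite exprS mulrC.
rewrite mulrC -ler_pdivrMr ?ltr0n ?fact_gt0//.
by apply: le_trans H; rewrite lerDr.
Qed.

Lemma is_derive_flat m t :
  is_derive t 1 (flat m) (flat m.+2 t - m%:R * flat m.+1 t).
Proof.
have [t0|t0|->] := ltgtP t 0.
- rewrite !flat_npos ?(ltW t0)// mulr0 subrr.
  apply: (@near_eq_is_derive R R R (cst 0)).
  by near=> z; rewrite flat_npos//; near: z; exact: lt_le_nbhsl.
- apply: (@near_eq_is_derive R R R (fun z => z^-1 ^+ m * expR (- z^-1))).
    by near=> z; rewrite /flat ifT//; near: z; exact: lt_nbhsr.
  have nt : t != 0 by rewrite gt_eqF.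
  have dV : is_derive t 1 (fun z : R => z^-1) (- t ^- 2).
    have := @is_deriveV R id t 1 1 nt (is_derive_id t 1).
    by rewrite scaler1.
  have dX := is_deriveX m dV.
  have dE : is_derive t 1 (fun z : R => expR (- z^-1)) (expR (- t^-1) * t ^- 2).
    have := @is_derive1_comp R expR (fun z => - z^-1) t _ _
      (is_derive_expR (- t^-1)) (is_deriveN dV).
    by rewrite opprK.
  rewrite (_ : (fun z => _) =
    ((fun z => z^-1) ^+ m) * (fun z => expR (- z^-1))); last first.
    by apply/funext => z; rewrite !fctE.
  apply: (is_derive_eq (is_deriveM dX dE)).
  rewrite /flat t0 /GRing.scale/= !fctE -exprVn.
  case: (m) => [|j]; first by rewrite !mul0r; ring.
  by rewrite /= !exprS; ring.
(* The difference quotients at 0 belong to the family [flat] themselves. *)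
- have f0 j : flat j 0 = 0 by rewrite flat_npos.
  rewrite !f0 mulr0 subrr.
  have H : h^-1 *: ((flat m \o shift 0) (h *: (1 : R)) - flat m 0) @[h --> 0^'] --> (0 : R).
    apply/cvgr0Pnorm_le => e e0; near=> h.
    have h0 : h != 0 by near: h; exact: nbhs_dnbhs_neq.
    rewrite /= addr0 f0 subr0 /GRing.scale/= mulr1.
    have [hneg|hpos] := leP h 0.
      by rewrite flat_npos// mulr0 normr0 ltW.
    have -> : h^-1 * flat m h = flat m.+1 h.
      by rewrite /flat hpos exprS mulrA.
    rewrite ger0_norm ?flat_ge0// (le_trans (flat_le_norm _ _))//.
    rewrite mulrC -ler_pdivlMr ?ltr0n ?fact_gt0//.
    near: h; apply: dnbhs0_le.
    by rewrite divr_gt0// ltr0n fact_gt0.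
  apply: DeriveDef; first exact: cvgP H.
  exact: cvg_lim H.
Unshelve. all: by end_near. Qed.

End flat.

(** * Smooth functions of several variables *)

Section smooth.
Variables (R : realType) (n : nat).
Local Notation V := 'rV[R]_n.
Local Notation e := (delta_mx ord0 : 'I_n -> V).
Implicit Types (f g : V -> R) (x v : V) (s : seq 'I_n) (m : nat).

(** Partial derivatives up to order [m] exist and are continuous. This recursive
    form of smoothness makes closure properties provable by induction. *)
Fixpoint Ck m f : Prop := continuous f /\
  if m is m'.+1 then
    forall i, (forall x, derivable f x (e i)) /\ Ck m' (fun x => 'D_(e i) f x)
  else True.

Lemma Ck_continuous m f : Ck m f -> continuous f.
Proof. by case: m => [|m] []. Qed.

Lemma CkS m f : Ck m.+1 f -> Ck m f.
Proof.
elim: m f => [|m IH] f [cf df]; first by split.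
by split=> // i; have [? /IH] := df i.
Qed.

Lemma pderiv_rcons s i f : pderiv (rcons s i) f = pderiv s (fun x => 'D_(e i) f x).
Proof. by rewrite /pderiv foldr_rcons. Qed.

Lemma smoothP f : smooth f <-> forall m, Ck m f.
Proof.
split=> [sf m|Cf s].
  elim: m f sf => [|m IH] f sf; first by split=> //; have [] := sf [::].
  split; first by have [] := sf [::].
  move=> i; split; first by move=> x; have [_ /(_ x i)] := sf [::].
  by apply: IH => s; rewrite -pderiv_rcons; exact: sf.
elim/last_ind: s f Cf => [|s i IH] f Cf.
  by split=> [|x i]; [exact: Ck_continuous (Cf 0)|have [_ /(_ i) []] := Cf 1].
by rewrite pderiv_rcons; apply: IH => m; have [_ /(_ i) []] := Cf m.+1.
Qed.

Lemma smooth_continuous f : smooth f -> continuous f.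
Proof. by move=> /(_ [::]) []. Qed.

Lemma smooth_pderiv s f : smooth f -> smooth (pderiv s f).
Proof. by move=> sf t; rewrite /pderiv -foldr_cat; exact: sf. Qed.

Lemma Ck_cst m (c : R) : Ck m (cst c).
Proof.
elim: m c => [|m IH] c; first by split=> //; exact: cst_continuous.
split=> [|i]; first exact: cst_continuous.
split=> [x|]; first exact: derivable_cst.
rewrite (_ : (fun x => _) = cst 0) //.
by apply/funext => x; rewrite derive_cst.
Qed.

Lemma CkD m f g : Ck m f -> Ck m g -> Ck m (f \+ g).
Proof.
elim: m f g => [|m IH] f g [cf df] [cg dg].
  by split=> // x; apply: continuousD; [exact: cf|exact: cg].
split=> [x|i]; first by apply: continuousD; [exact: cf|exact: cg].
have [df1 df2] := df i; have [dg1 dg2] := dg i.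
split=> [x|]; first exact: derivableD.
rewrite (_ : (fun x => _) = (fun x => 'D_(e i) f x) \+ (fun x => 'D_(e i) g x)).
  exact: IH.
by apply/funext => x; rewrite deriveD.
Qed.

Lemma CkM m f g : Ck m f -> Ck m g -> Ck m (f \* g).
Proof.
elim: m f g => [|m IH] f g.
  by move=> [cf df] [cg dg]; split=> // x; apply: continuousM; [exact: cf|exact: cg].
move=> Cf Cg; have [cf df] := Cf; have [cg dg] := Cg.
split=> [x|i]; first by apply: continuousM; [exact: cf|exact: cg].
have [df1 df2] := df i; have [dg1 dg2] := dg i.
split=> [x|]; first exact: derivableM.
rewrite (_ : (fun x => _) =
    (f \* (fun x => 'D_(e i) g x)) \+ (g \* (fun x => 'D_(e i) f x))).
  by apply: CkD; apply: IH => //; exact: CkS.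
by apply/funext => x; rewrite deriveM.
Qed.

Lemma is_derive_line f x v df :
  is_derive x v f df <-> is_derive (0 : R) (1 : R) (fun h => f (h *: v + x)) df.
Proof.
suff E : (fun h : R => h^-1 *: ((f \o shift x) (h *: v) - f x)) =
    (fun h : R => h^-1 *: (((fun h => f (h *: v + x)) \o shift 0) (h *: (1 : R)) -
        f ((0 : R) *: v + x))).
  by split=> -[]; rewrite /derivable /derive => ? ?; split;
    rewrite ?/derivable ?/derive ?E // -?E.
by apply/funext => h /=; rewrite addr0 scale0r add0r [_%:A]mulr1.
Qed.

Lemma is_derive_along f x v (t df : R) : is_derive (t *: v + x) v f df ->
  is_derive t 1 (fun h => f (h *: v + x)) df.
Proof.
move=> /is_derive_line D.
have D1 : is_derive t 1 (fun w : R => w - t) 1.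
  have := is_deriveB (is_derive_id t 1) (is_derive_cst t t 1).
  by rewrite subr0.
rewrite (_ : (fun h => _) =
    (fun w => f (w *: v + (t *: v + x))) \o (fun w => w - t)); last first.
  by apply/funext => w /=; rewrite addrA -scalerDl subrK.
by rewrite -[df]mulr1; apply: is_derive1_comp D1; rewrite subrr.
Qed.

Lemma is_derive_comp_real (h : R -> R) f x v dh df :
  is_derive (f x) 1 h dh -> is_derive x v f df ->
  is_derive x v (h \o f) (dh * df).
Proof.
move=> dhf /is_derive_line dfx; apply/is_derive_line.
by apply: is_derive1_comp => //; rewrite scale0r add0r.
Qed.

(** The whole family [flat j] is needed for the induction to go through, since
    derivation raises [j]. *)
Lemma Ck_flat m f j : Ck m f -> Ck m (flat j \o f).
Proof.
have flatc i t : {for t, continuous (@flat R i)}.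
  apply/differentiable_continuous/derivable1_diffP.
  by have [] := is_derive_flat i t.
elim: m f j => [|m IH] f j Cf.
  split=> // x; apply: continuous_comp; last exact: flatc.
  exact: (Ck_continuous Cf).
have [cf df] := Cf.
split=> [x|i].
  by apply: continuous_comp; [exact: cf|exact: flatc].
have [df1 df2] := df i.
have dx x : is_derive x (e i) (flat j \o f)
    ((flat j.+2 (f x) - j%:R * flat j.+1 (f x)) * 'D_(e i) f x).
  apply: is_derive_comp_real; last exact/derivableP.
  exact: is_derive_flat.
split=> [x|]; first by have [] := dx x.
rewrite (_ : (fun x => _) = ((flat j.+2 \o f) \+ (cst (- j%:R) \* (flat j.+1 \o f)))
   \* (fun x => 'D_(e i) f x)).
  apply: CkM => //; apply: CkD; first exact/IH/CkS.
  by apply: CkM; [exact: Ck_cst|exact/IH/CkS].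
by apply/funext => x; rewrite derive_val /= mulNr.
Qed.

Lemma is_derive_coord x v (i : 'I_n) :
  is_derive x v (fun x : V => x ord0 i) (v ord0 i).
Proof.
apply/is_derive_line.
rewrite (_ : (fun h => _) = (fun h : R => h * v ord0 i + x ord0 i)); last first.
  by apply/funext => h; rewrite !mxE.
have D := is_deriveD (is_deriveM (is_derive_id (0:R) (1:R))
  (is_derive_cst (v ord0 i) (0:R) (1:R))) (is_derive_cst (x ord0 i) (0:R) (1:R)).
apply: (is_derive_eq D).
by rewrite scaler0 add0r addr0 /GRing.scale/= mulr1.
Qed.

Lemma Ck_coord m (i : 'I_n) : Ck m (fun x : V => x ord0 i).
Proof.
have c0 : continuous (fun x : V => x ord0 i) by exact: coord_continuous.
case: m => [|m]; first by split.
split=> // j; split=> [x|]; first by have [] := is_derive_coord x (e j) i.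
rewrite (_ : (fun x => _) = cst (e j ord0 i)); first exact: Ck_cst.
by apply/funext => x; have [_] := is_derive_coord x (e j) i.
Qed.

Lemma smooth_cst (c : R) : smooth (fun _ : V => c).
Proof. by apply/smoothP => m; exact: (Ck_cst m c). Qed.

Lemma smoothD f g : smooth f -> smooth g -> smooth (fun x => f x + g x).
Proof. by move=> /smoothP sf /smoothP sg; apply/smoothP => m; exact: CkD. Qed.

Lemma smoothM f g : smooth f -> smooth g -> smooth (fun x => f x * g x).
Proof. by move=> /smoothP sf /smoothP sg; apply/smoothP => m; exact: CkM. Qed.

Lemma smooth_flat j f : smooth f -> smooth (fun x => flat j (f x)).
Proof. by move=> /smoothP sf; apply/smoothP => m; exact: Ck_flat. Qed.

Lemma smooth_coord (i : 'I_n) : smooth (fun x : V => x ord0 i).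
Proof. by apply/smoothP => m; exact: Ck_coord. Qed.

Lemma smooth_prod (I : Type) (r : seq I) (F : I -> V -> R) :
  (forall i, smooth (F i)) -> smooth (fun x => \prod_(i <- r) F i x).
Proof.
move=> sF; elim: r => [|i r IH].
  by under eq_fun do rewrite big_nil; exact: smooth_cst.
under eq_fun do rewrite big_cons; exact: smoothM (sF i) IH.
Qed.

Lemma smooth_sum (I : Type) (r : seq I) (F : I -> V -> R) :
  (forall i, smooth (F i)) -> smooth (fun x => \sum_(i <- r) F i x).
Proof.
move=> sF; elim: r => [|i r IH].
  by under eq_fun do rewrite big_nil; exact: smooth_cst.
under eq_fun do rewrite big_cons; exact: smoothD (sF i) IH.
Qed.

Lemma pderivD s f g : smooth f -> smooth g ->
  pderiv s (f \+ g) = pderiv s f \+ pderiv s g.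
Proof.
move=> sf sg; elim: s => //= i s ->; apply/funext => x /=.
by rewrite deriveD//; [have [_] := sf s|have [_] := sg s].
Qed.

Lemma pderivZ s (c : R) f : smooth f ->
  pderiv s (fun x => c * f x) = fun x => c * pderiv s f x.
Proof.
move=> sf; elim: s => //= i s ->; apply/funext => x /=.
by rewrite deriveMl//; have [_] := sf s.
Qed.

Lemma pderiv_near s f g x : (\near x, f x = g x) -> \near x, pderiv s f x = pderiv s g x.
Proof.
move=> fg; elim: s => //= i s IH.
have := near_join IH; apply: filterS => y; exact: near_eq_derive.
Qed.

Lemma pderiv_local s f g (U : set V) : open U -> {in U, f =1 g} ->
  {in U, pderiv s f =1 pderiv s g}.
Proof.
move=> oU fg x; rewrite inE => Ux.
apply: (@nbhs_singleton _ x (fun x => pderiv s f x = pderiv s g x)).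
apply: pderiv_near; near=> y; apply: fg; rewrite inE.
by near: y; exact: open_nbhs_nbhs.
Unshelve. all: by end_near. Qed.

Lemma is_derive_affine f (q x v : V) (r df : R) :
  is_derive (r *: (x - q)) v f df ->
  is_derive x v (fun x => f (r *: (x - q))) (r * df).
Proof.
move=> /is_derive_line D; apply/is_derive_line.
rewrite (_ : (fun h => _) =
    (fun h => f (h *: v + r *: (x - q))) \o (fun h => r * h)); last first.
  by apply/funext => h /=; rewrite -scalerA -scalerDr addrA.
rewrite mulrC; apply: is_derive1_comp; first by rewrite mulr0.
have D' := is_deriveZ r (is_derive_id (0 : R) (1 : R)).
by apply: (is_derive_eq D'); rewrite /GRing.scale/= mulr1.
Qed.

Lemma Ck_affine m f (q : V) (r : R) : Ck m f -> Ck m (fun x => f (r *: (x - q))).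
Proof.
have ca : continuous (fun x : V => r *: (x - q)).
  move=> x; apply: (@continuousZ _ _ _ (cst r) (fun x => x - q)).
    exact: cst_continuous.
  by apply: continuousB => //; exact: cst_continuous.
elim: m f => [|m IH] f [cf df].
  by split=> // x; apply: continuous_comp; [exact: ca|exact: cf].
split=> [x|i]; first by apply: continuous_comp; [exact: ca|exact: cf].
have [df1 df2] := df i.
have dx x := is_derive_affine (derivableP (df1 (r *: (x - q)))).
split=> [x|]; first by have [] := dx x.
rewrite (_ : (fun x => _) = cst r \* (fun x => 'D_(e i) f (r *: (x - q)))).
  by apply: CkM; [exact: Ck_cst|exact: (IH (fun x => 'D_(e i) f x))].
by apply/funext => x; have [_ ->] := dx x.
Qed.

Lemma smooth_affine f (q : V) (r : R) : smooth f ->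
  smooth (fun x => f (r *: (x - q))).
Proof. by move=> /smoothP sf; apply/smoothP => m; exact: Ck_affine. Qed.

Lemma pderiv_affine f (q : V) (r : R) s : smooth f ->
  pderiv s (fun x => f (r *: (x - q))) =
  fun x => r ^+ size s * pderiv s f (r *: (x - q)).
Proof.
move=> sf; elim: s => [|i s IH]; first by apply/funext => x; rewrite mul1r.
rewrite /= IH; apply/funext => x.
have sfs := smooth_pderiv s sf; have [_ /(_ (r *: (x - q)) i) D] := sfs [::].
have D' := is_derive_affine (derivableP D).
rewrite deriveMl; last by have [] := D'.
by have [_ ->] := D'; rewrite exprSr mulrA.
Qed.

End smooth.

(** * Test functions, bumps and cutoffs *)

Section test_functions.
Variables (R : realType) (n : nat).
Local Notation V := 'rV[R]_n.
Local Notation e := (delta_mx ord0 : 'I_n -> V).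
Implicit Types (f g phi : V -> R) (x v q a b : V) (s : seq 'I_n) (U K Omega : set V).

Lemma supported_test_function Omega K f : smooth f -> compact K -> K `<=` Omega ->
  (forall x, ~ K x -> f x = 0) -> test_function Omega f.
Proof.
move=> sf cK KO f0.
have clK : closed K by exact: compact_closed.
have sK : closure [set x | f x != 0] `<=` K.
  rewrite [X in _ `<=` X](iffLR (closure_id K) clK).
  by apply: closure_subset => x /= /eqP fx; apply: contrapT => /f0.
split=> //; last exact: subset_trans KO.
by apply: (subclosed_compact _ cK) => //; exact: closed_closure.
Qed.

Lemma test_function_support Omega phi : test_function Omega phi ->
  exists K, [/\ compact K, K `<=` Omega & forall x, ~ K x -> phi x = 0].
Proof.
move=> [_ cK KO]; exists (closure [set x | phi x != 0]); split=> // x Kx.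
by apply/eqP; apply: contra_notT Kx => ?; exact: subset_closure.
Qed.

Lemma test_function_smooth Omega phi : test_function Omega phi -> smooth phi.
Proof. by case. Qed.

Lemma test_functionS Omega Omega' phi : Omega `<=` Omega' ->
  test_function Omega phi -> test_function Omega' phi.
Proof. by move=> OO' [sp cp pO]; split=> //; exact: subset_trans OO'. Qed.

Lemma pderiv_supported K f s : closed K -> (forall x, ~ K x -> f x = 0) ->
  forall x, ~ K x -> pderiv s f x = 0.
Proof.
move=> clK f0 x Kx.
have -> : pderiv s f x = pderiv s (cst 0) x.
  apply: (@pderiv_local _ _ s f (cst 0) (~` K)); last by rewrite inE.
    exact: closed_openC.
  by move=> y; rewrite inE => /f0.
elim: s x {Kx} => //= i s IH x.
by rewrite (_ : pderiv s _ = cst 0) ?derive_cst//; apply/funext => y; rewrite IH.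
Qed.

Lemma pderiv_test Omega phi s :
  test_function Omega phi -> test_function Omega (pderiv s phi).
Proof.
move=> tp; have [K [cK KO p0]] := test_function_support tp.
apply: (supported_test_function _ cK KO).
  by apply: smooth_pderiv; exact: test_function_smooth tp.
by apply: pderiv_supported => //; exact: compact_closed.
Qed.

Lemma compact_support_bounded K f : continuous f -> compact K ->
  (forall x, ~ K x -> f x = 0) -> exists2 M, 0 < M & forall x, `|f x| <= M.
Proof.
move=> cf cK f0.
have [M0 [_ /(_ (`|M0| + 1))]] : bounded_set (f @` K).
  apply: compact_bounded; apply: continuous_compact => //.
  exact: continuous_subspaceT.
rewrite (le_lt_trans (ler_norm M0)) ?ltrDl// => /(_ isT) fK.
have M1 : 0 < `|M0| + 1 by rewrite ltr_wpDl.
exists (`|M0| + 1) => // x; have [Kx|Kx] := pselect (K x).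
  by apply: fK; exists x.
by rewrite f0// normr0 ltW.
Qed.

Lemma test_function_bounded Omega phi : test_function Omega phi ->
  exists2 M, 0 < M & forall x, `|phi x| <= M.
Proof.
move=> tp; have [K [cK _ p0]] := test_function_support tp.
apply: compact_support_bounded cK p0.
exact: smooth_continuous (test_function_smooth tp).
Qed.

Lemma test_functionM Omega f phi : smooth f -> test_function Omega phi ->
  test_function Omega (f \* phi).
Proof.
move=> sf tp; have [K [cK KO p0]] := test_function_support tp.
apply: (supported_test_function _ cK KO).
  exact: smoothM sf (test_function_smooth tp).
by move=> x /p0 /= ->; rewrite mulr0.
Qed.

Lemma test_function0 Omega : test_function Omega (fun=> 0).
Proof. by apply: (supported_test_function _ compact0) => //; exact: smooth_cst. Qed.

Lemma test_functionD Omega f phi : test_function Omega f ->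
  test_function Omega phi -> test_function Omega (f \+ phi).
Proof.
move=> tf tp; have [K [cK KO p0]] := test_function_support tp.
have [K' [cK' KO' p0']] := test_function_support tf.
apply: (supported_test_function _ (compactU cK cK')).
- by apply: smoothD; [exact: test_function_smooth tf|exact: test_function_smooth tp].
- by move=> x [/KO|/KO'].
- by move=> x /not_orP[/p0 h /p0' h'] /=; rewrite h h' addr0.
Qed.

(** Positive exactly in the interior of the box, where increasing [c] pushes the
    values towards 1. *)
Definition box_bump (c : R) a b x : R :=
  \prod_(i < n) (flat 0 (c * (x ord0 i - a ord0 i)) * flat 0 (c * (b ord0 i - x ord0 i))).

Lemma box_bump_ge0 c a b x : 0 <= box_bump c a b x.
Proof. by apply: prodr_ge0 => i _; rewrite mulr_ge0// flat_ge0. Qed.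

Lemma box_bump_le1 c a b x : box_bump c a b x <= 1.
Proof.
suff /andP[] : 0 <= box_bump c a b x <= 1 by [].
rewrite /box_bump; elim/big_ind : _ => [|y z /andP[y0 y1] /andP[z0 z1]|i _].
- by rewrite ler01 lexx.
- by rewrite mulr_ge0// mulr_ile1.
- by rewrite mulr_ge0 ?flat_ge0// mulr_ile1 ?flat_ge0 ?flat0_le1.
Qed.

Lemma smooth_box_bump c a b : smooth (box_bump c a b).
Proof.
apply: smooth_prod => i; apply: smoothM; apply: smooth_flat;
  apply: smoothM; try exact: smooth_cst.
  by apply: smoothD; [exact: smooth_coord|exact: smooth_cst].
apply: smoothD; first exact: smooth_cst.
under eq_fun do rewrite -mulN1r.
by apply: smoothM; [exact: smooth_cst|exact: smooth_coord].
Qed.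

Lemma box_bump0 c a b x : 0 < c -> ~ box a b x -> box_bump c a b x = 0.
Proof.
move=> c0 /existsNP[i]; rewrite in_itv/= => /negP; rewrite negb_and -!ltNge => xi.
rewrite /box_bump (bigD1 i)//=; case/orP: xi => xi.
  by rewrite flat_npos ?mul0r// pmulr_rle0// subr_le0 ltW.
by rewrite mulrC [X in _ * X]mulrC (flat_npos _ (_ : c * (b _ _ - _) <= 0))
  ?mul0r ?mulr0// pmulr_rle0// subr_le0 ltW.
Qed.

Lemma box_bump_gt0 c a b x : 0 < c ->
  (forall i, a ord0 i < x ord0 i < b ord0 i) -> 0 < box_bump c a b x.
Proof.
move=> c0 xab; apply: prodr_gt0 => i _; have /andP[ax xb] := xab i.
by rewrite mulr_gt0// flat_gt0// mulr_gt0// subr_gt0.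
Qed.

Definition unit_bump := box_bump 1 (const_mx (-1)) (const_mx 1).

Lemma unit_bump_cube x : ~ cube 0 1 x -> unit_bump x = 0.
Proof.
by rewrite cube_box// => Bx; apply: box_bump0 => // bx; apply: Bx => i;
  have := bx i; rewrite !in_itv/= !mxE sub0r add0r.
Qed.

Lemma unit_bump0 : 0 < unit_bump 0.
Proof. by apply: box_bump_gt0 => // i; rewrite !mxE; lra. Qed.

Lemma cube_rescale q (r : R) x : 0 < r ->
  cube 0 1 (r^-1 *: (x - q)) <-> cube q r x.
Proof.
move=> r0; rewrite /cube/= subr0 normrZ gtr0_norm ?invr_gt0//.
by rewrite ler_pdivrMl// mulr1.
Qed.

(** Finitely many normalised bumps have a sum [beta] exceeding 1 near [K]. The
    function [1 - flat 0 (1 - beta) / flat 0 1] equals 1 where [beta] is at least 1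
    and vanishes with [beta]. *)
Lemma exists_cutoff K U : compact K -> open U -> K `<=` U ->
  exists chi W, [/\ test_function U chi, open W, K `<=` W &
    {in W, forall x, chi x = 1}].
Proof.
move=> cK oU KU.
have /choice[r hr] : forall x, exists r : R, K x -> 0 < r /\ cube x r `<=` U.
  move=> x; have [Kx|Kx] := pselect (K x); last by exists 0.
  have /nbhs_ballP [d /= d0 dU] : nbhs x U by apply: open_nbhs_nbhs; split=> //; exact: KU.
  exists (d / 2) => _; split; first by rewrite divr_gt0.
  move=> y; rewrite /cube/= => yx; apply: dU; rewrite -ball_normE/= distrC.
  by rewrite (le_lt_trans yx)// ltr_pdivrMr// ltr_pMr// ltr1n.
pose p x y := 2 / unit_bump 0 * unit_bump ((r x)^-1 *: (y - x)).
have sp x : smooth (p x).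
  apply: smoothM; first exact: smooth_cst.
  apply: smooth_affine.
  exact: smooth_box_bump.
have p_ge0 x y : 0 <= p x y.
  by rewrite mulr_ge0 ?box_bump_ge0// divr_ge0// ltW// unit_bump0.
have p_cube x y : K x -> ~ cube x (r x) y -> p x y = 0.
  move=> Kx; have [rx _] := hr x Kx; move=> Cy.
  by rewrite /p [X in _ * X]unit_bump_cube ?mulr0// => /(cube_rescale _ _ rx).
have [D DK KD] : finite_subset_cover K (fun x => p x @^-1` `]1, +oo[%classic) K.
  move: cK; rewrite compact_cover; apply.
    move=> x _; apply: open_comp => [y _|]; last exact: interval_open.
    exact: smooth_continuous.
  move=> x Kx; exists x => //=; rewrite in_itv/= andbT /p subrr scaler0.
  by rewrite divfK ?gt_eqF ?unit_bump0// ltr1n.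
pose beta y := \sum_(x <- finmap.enum_fset D) p x y.
have sbeta : smooth beta by exact: smooth_sum.
pose chi y := 1 + - (flat 0 (1 : R))^-1 * flat 0 (1 + -1 * beta y).
have f1 : flat 0 (1 : R) != 0 by rewrite gt_eqF// flat_gt0.
exists chi, (beta @^-1` `]1, +oo[%classic); split.
- apply: (@supported_test_function U (\big[setU/set0]_(x <- finmap.enum_fset D) cube x (r x))).
  + apply: smoothD; first exact: smooth_cst.
    apply: smoothM; first exact: smooth_cst.
    apply: smooth_flat; apply: smoothD; first exact: smooth_cst.
    by apply: smoothM; first exact: smooth_cst.
  + by apply: bigsetU_compact => x _; exact: compact_cube.
  + rewrite -bigcup_seq => y [x /= /DK]; rewrite inE => Kx xy.
    by have [_] := hr x Kx; apply.
  + move=> y; rewrite -bigcup_seq => yD.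
    rewrite /chi (_ : beta y = 0) ?mulr0 ?addr0 ?mulNr ?mulVf ?subrr//.
    rewrite /beta big1_seq// => x /andP[_ xD]; apply: p_cube.
      by have := DK _ xD; rewrite inE.
    by move=> xy; apply: yD; exists x.
- by apply: open_comp => [y _|]; [exact: smooth_continuous|exact: interval_open].
- move=> y /KD [x /= xD]; rewrite !in_itv/= !andbT => xy.
  rewrite (lt_le_trans xy)// /beta (big_rem x xD) lerDl.
  by apply: sumr_ge0 => z _; exact: p_ge0.
- move=> y; rewrite inE/= in_itv/= andbT => y1.
  by rewrite /chi (flat_npos 0 (_ : 1 + -1 * beta y <= 0)) ?mulr0 ?addr0//; lra.
Qed.

(** If an iterated derivative vanished identically, the previous one would be
    constant along lines, hence zero since lines leave the support. *)
Lemma pderiv_nseq_neq0 f K i k : smooth f -> compact K ->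
  (forall x, ~ K x -> f x = 0) -> (exists x, f x != 0) ->
  exists x, pderiv (nseq k i) f x != 0.
Proof.
move=> sf cK f0 fx; elim: k => // k [x gx].
apply: contrapT => /forallNP dg; apply/negP: gx; rewrite negbK; apply/eqP.
set g := pderiv (nseq k i) f in dg *.
have clK : closed K by exact: compact_closed.
have gcst (h : R) : g (h *: e i + x) = g x.
  rewrite -[RHS](_ : (fun h => g (h *: e i + x)) 0 = _); last by rewrite scale0r add0r.
  apply: (@is_derive_0_is_cst R (fun h => g (h *: e i + x))) => t.
  have [_ /(_ (t *: e i + x) i)] := sf (nseq k i).
  move=> /derivableP; rewrite -/g.
  have -> : 'D_(e i) g (t *: e i + x) = 0.
    by apply/eqP; apply: contrapT => /negP /(dg _).
  exact: is_derive_along.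
have [M [_ /(_ (`|M| + 1))]] := compact_bounded cK.
rewrite (le_lt_trans (ler_norm M)) ?ltrDl// => /(_ isT) KM.
pose h := `|M| + 2 + `|x|.
rewrite -(gcst h); apply: pderiv_supported clK f0 _ _ => /KM.
apply/negP; rewrite -ltNge; apply: (@lt_le_trans _ _ (h - `|x|)).
  by rewrite /h; lra.
apply: le_trans (ler_coord_norm _ i); rewrite !mxE !eqxx mulr1.
have := ler_coord_norm x i.
rewrite ler_norml => /andP[x1 x2]; rewrite ler_normr; apply/orP; left; lra.
Qed.

End test_functions.

(** * Integration by parts against test functions *)

Section integration.
Variables (R : realType) (n : nat).
Local Notation V := 'rV[R]_n.
Local Notation mu := (lebesgue_rV R n).
Local Notation e := (delta_mx ord0 : 'I_n -> V).
Implicit Types (f g phi : V -> R) (x v q a b : V) (s : seq 'I_n) (U K D Omega : set V).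

Lemma compact_sub_cube K : compact K -> exists2 M : R, 0 < M & K `<=` cube 0 M.
Proof.
move=> /compact_bounded [M [_ /(_ (`|M| + 1))]].
rewrite (le_lt_trans (ler_norm M)) ?ltrDl// => /(_ isT) KM.
exists (`|M| + 1); first by rewrite ltr_wpDl.
by move=> x /KM; rewrite /cube/= subr0.
Qed.

Lemma measurable_compact K : compact K -> measurable K.
Proof.
move=> cK; rewrite -[K]setCK; apply: measurableC; apply: open_measurable_rV.
by apply: closed_openC; exact: compact_closed.
Qed.

Lemma lebesgue_compact_fin K : compact K -> (mu K < +oo)%E.
Proof.
move=> cK; have [M M0 KM] := compact_sub_cube cK.
apply: (@le_lt_trans _ _ (mu (cube 0 M))); last by rewrite lebesgue_cube ?ltry// ltW.
by apply: le_measure; rewrite ?inE//; [exact: measurable_compact|exact: measurable_cube].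
Qed.

Lemma integrable_support D K (f : V -> \bar R) : measurable D -> measurable K ->
  K `<=` D -> (forall x, D x -> ~ K x -> f x = 0%E) ->
  mu.-integrable K f -> mu.-integrable D f.
Proof.
move=> mD mK KD f0; rewrite (integrable_mkcond _ mK) (integrable_mkcond _ mD).
rewrite (_ : f \_ K = f \_ D)//; apply/funext => x; rewrite /patch.
case: ifPn; rewrite ?inE ?notin_setE => Kx; first by rewrite mem_set//; exact: KD.
by case: ifPn => //; rewrite inE => Dx; rewrite f0.
Qed.

Lemma integrable_compact_support K f : compact K -> measurable_fun setT f ->
  (exists M, forall x, `|f x| <= M) -> (forall x, ~ K x -> f x = 0) ->
  mu.-integrable setT (EFin \o f).
Proof.
move=> cK mf [M fM] f0; have mK := measurable_compact cK.
apply: (integrable_support _ mK) => // [x _ Kx|]; first by rewrite /= f0.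
apply: measurable_bounded_integrable => //.
- exact: lebesgue_compact_fin.
- exact: measurable_funTS.
- exists M; split; first exact: num_real.
  by move=> y My x _; exact: le_trans (fM x) (ltW My).
Qed.

Lemma test_function_measurable Omega phi D :
  test_function Omega phi -> measurable_fun D phi.
Proof.
move=> tp; apply: measurable_funTS; apply: continuous_measurable_rV.
exact: smooth_continuous (test_function_smooth tp).
Qed.

Lemma test_function_integrable Omega phi : test_function Omega phi ->
  mu.-integrable setT (EFin \o phi).
Proof.
move=> tp; have [K [cK _ p0]] := test_function_support tp.
apply: (integrable_compact_support cK) => //.
  exact: test_function_measurable tp.
by have [M _ pM] := test_function_bounded tp; exists M.
Qed.

Lemma test_function_shift Omega phi a : test_function Omega phi ->
  test_function setT (fun x => phi (x + a)).
Proof.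
move=> tp; have [K [cK _ p0]] := test_function_support tp.
apply: (@supported_test_function _ _ _ ((fun x => x - a) @` K)) => //.
- rewrite (_ : (fun x => _) = (fun x => phi (1 *: (x - (- a))))).
    by apply: smooth_affine; exact: test_function_smooth tp.
  by apply/funext => x; rewrite scale1r opprK.
- apply: continuous_compact => //; apply: continuous_subspaceT => x.
  by apply: continuousB => //; exact: cst_continuous.
- move=> x Kx; apply: p0 => Kxa; apply: Kx; exists (x + a) => //.
  by rewrite addrK.
Qed.

Lemma integral_shift Omega phi a : test_function Omega phi ->
  (\int[mu]_x (phi ((x : V) + a))%:E = \int[mu]_x (phi x)%:E)%E.
Proof.
move=> tp; have mshift : measurable_fun setT (fun x : V => x + a).
  apply: measurable_fun_rV => i; apply: continuous_measurable_rV => x.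
  apply: (@continuous_comp _ _ _ (fun x : V => x + a)); last exact: coord_continuous.
  by apply: continuousD => //; exact: cst_continuous.
have mp : measurable_fun setT (EFin \o phi).
  by apply/measurable_EFinP; exact: test_function_measurable tp.
have := integral_pushforward mshift mp
  (test_function_integrable (test_function_shift a tp)) measurableT.
rewrite preimage_setT => <-; apply: eq_measure_integral => A mA _.
by rewrite -[RHS](lebesgue_rV_shift a mA).
Qed.

(** Derivatives of test functions have zero mean: translation invariance makes
    the mean of every difference quotient vanish. *)
Lemma integral_derive Omega f i : test_function Omega f ->
  (\int[mu]_x ('D_(e i) f x)%:E = 0)%E.
Proof.
move=> tf; have [K [cK _ f0]] := test_function_support tf.
have tdf : test_function Omega (fun x => 'D_(e i) f x) := pderiv_test [:: i] tf.
have [M M0 dM] := test_function_bounded tdf.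
have sf := test_function_smooth tf.
have [L L0 KL] := compact_sub_cube cK.
pose h j : R := j.+1%:R^-1.
have h0 j : 0 < h j by rewrite invr_gt0 ltr0n.
have h1 j : h j <= 1 by rewrite invf_le1 ?ler1n.
have derf x : derivable f x (e i) by have [_] := sf [::].
pose g j x := (h j)^-1 * (f (x + h j *: e i) - f x).
have mg j : measurable_fun setT (g j).
  apply: measurable_funM => //; apply: measurable_funB.
    exact: test_function_measurable (test_function_shift _ tf).
  exact: test_function_measurable tf.
have gM j x : `|g j x| <= M.
  rewrite /g normrM gtr0_norm ?invr_gt0// ler_pdivrMl//.
  have [c _] : exists2 c, c \in `]0, h j[ &
      f (h j *: e i + x) - f (0 *: e i + x) = 'D_(e i) f (c *: e i + x) * (h j - 0).
    apply: (@MVT R (fun t => f (t *: e i + x)) (fun t => 'D_(e i) f (t *: e i + x))) => //.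
      move=> t _.
      exact/is_derive_along/derivableP.
    apply: continuous_subspaceT => t.
    apply: (@continuous_comp _ _ _ (fun t : R => t *: e i + x) f).
      apply: continuousD; last exact: cst_continuous.
      apply: (@continuousZ _ _ _ (fun t : R => t) (cst (e i))) => //.
      exact: cst_continuous.
    exact: smooth_continuous.
  rewrite scale0r add0r subr0 [_ + x]addrC => ->.
  by rewrite normrM mulrC gtr0_norm// ler_wpM2l// ltW.
have gint j : (\int[mu]_x (g j x)%:E = 0)%E.
  have fi := test_function_integrable tf.
  have fsi : mu.-integrable setT (fun x => (f (x + h j *: e i))%:E).
    by have := test_function_integrable (test_function_shift (h j *: e i) tf).
  under eq_integral do rewrite EFinM EFinB.
  rewrite integralZl//; last exact: integrableB.
  rewrite integralB// (integral_shift _ tf) subee ?mule0//.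
  exact: integrable_fin_num.
have C : (\int[mu]_x (g j x)%:E)%E @[j --> \oo] --> (\int[mu]_x ('D_(e i) f x)%:E)%E.
  have LM : mu.-integrable setT (EFin \o ((cst M : V -> R) \_ (cube 0 (L + 1)))).
    apply: (@integrable_compact_support (cube 0 (L + 1))).
    - exact: compact_cube.
    - by apply/(measurable_restrictT _ (measurable_cube _ _)).
    - exists M => x; rewrite /patch; case: ifP => _.
        by rewrite gtr0_norm.
      by rewrite normr0 ltW.
    - by move=> x Kx; rewrite /patch memNset.
  apply: (@dominated_cvg _ _ _ mu setT measurableT (fun j x => (g j x)%:E) _
    (EFin \o ((cst M : V -> R) \_ (cube 0 (L + 1))))) => //.
  - by move=> j; apply/measurable_EFinP; exact: mg.
  - move=> x _; apply: cvg_EFin; first exact: nearW.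
    have hd : h j @[j --> \oo] --> (0 : R)^'.
      move=> A A0.
      have H : \forall j \near \oo, h j != 0 -> A (h j) := @cvg_harmonic R _ A0.
      suff : \forall j \near \oo, A (h j) by [].
      by apply: filterS H => k; apply; rewrite gt_eqF.
    apply: cvg_trans (cvg_comp _ _ hd (derf x)); apply: near_eq_cvg.
    by apply: nearW => k /=; rewrite /g [_ + x]addrC.
  - move=> j x _; rewrite lee_fin /patch; case: ifPn => [_|]; first exact: gM.
    rewrite notin_setE /cube/= subr0 => /negP; rewrite -ltNge => xL.
    rewrite /g !f0 ?subrr ?mulr0 ?normr0// => /KL; rewrite /cube/= subr0.
      by move=> xL'; have := lt_le_trans xL xL'; rewrite ltNge lerDl ler01.
    have ei : `|h j *: e i| <= 1.
      apply: rV_norm_le => // l; rewrite !mxE normrM gtr0_norm//.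
      by rewrite normr_nat mulr_ile1 ?ler0n ?lern1 ?leq_b1// ltW.
    move=> xL'; have := ler_normB (x + h j *: e i) (h j *: e i).
    by rewrite addrK; lra.
have /cvg_lim := C; move/(_ (@ereal_hausdorff _)) <-.
by under eq_fun do rewrite gint; exact: lim_cst.
Qed.

End integration.

(** * The fundamental lemma of the calculus of variations *)

Section density.
Variables (R : realType) (n : nat) (f : 'rV[R]_n -> \bar R).
Hypotheses (mf : measurable_fun setT f) (f0 : forall x, (0 <= f x)%E).
Local Notation mu := (lebesgue_rV R n).

(** The proofs are arguments so that the measure structure can be attached to the
    set function. *)
Definition density of measurable_fun setT f & (forall x, (0 <= f x)%E) :=
  fun A : set 'rV[R]_n => (\int[mu]_(x in A) f x)%E.

Let density0 : density mf f0 set0 = 0%E.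
Proof. exact: integral_set0. Qed.

Let density_ge0 A : (0 <= density mf f0 A)%E.
Proof. by apply: integral_ge0 => x _; exact: f0. Qed.

Let density_sigma_additive : semi_sigma_additive (density mf f0).
Proof. exact: semi_sigma_additive_nng_induced. Qed.

HB.instance Definition _ := isMeasure.Build _ _ _ (density mf f0)
  density0 density_ge0 density_sigma_additive.

End density.

Section fundamental_lemma.
Variables (R : realType) (n : nat).
Local Notation V := 'rV[R]_n.
Local Notation mu := (lebesgue_rV R n).
Implicit Types (f g phi : V -> R) (x v q a b : V) (s : seq 'I_n) (U K D Omega W : set V).

(** The positive and negative parts of [f] are densities of two measures that
    agree on boxes, hence everywhere. *)
Lemma ae_eq0_of_box_integrals (f : V -> \bar R) : mu.-integrable setT f ->
  (forall a b, \int[mu]_(x in box a b) f x = 0)%E -> ae_eq mu setT f (cst 0%E).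
Proof.
move=> fi f0.
have mp := measurable_funepos (measurable_int _ fi).
have mn := measurable_funeneg (measurable_int _ fi).
have fpi : mu.-integrable setT f^\+%E by exact: integrable_funepos.
have fni : mu.-integrable setT f^\-%E by exact: integrable_funeneg.
have pfin A : measurable A -> (\int[mu]_(x in A) f^\+ x)%E \is a fin_num.
  by move=> mA; apply: integrable_fin_num => //; exact: integrableS fpi.
have nfin A : measurable A -> (\int[mu]_(x in A) f^\- x)%E \is a fin_num.
  by move=> mA; apply: integrable_fin_num => //; exact: integrableS fni.
have pnE A : measurable A ->
    (\int[mu]_(x in A) f^\+ x = \int[mu]_(x in A) f^\- x)%E.
  apply: (@measure_box_unique _ _
    (density mp (funepos_ge0 f)) (density mn (funeneg_ge0 f))) => a b.
    by rewrite ltey_eq pfin//; exact: measurable_box.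
  have := f0 a b; rewrite integralE /= /density => /eqP.
  have mab := measurable_box a b.
  rewrite sube_eq ?pfin ?nfin ?add0e//; by move/eqP.
apply: integral_ae_eq => // E _ mE.
by rewrite integral0 integralE pnE// subee// nfin.
Qed.

Lemma locally_L1_test_integrable D f phi : measurable D ->
  locally_L1 D f -> test_function D phi ->
  mu.-integrable D (fun x => (f x * phi x)%:E).
Proof.
move=> mD [mf fi] tp; have [K [cK KD p0]] := test_function_support tp.
have mK := measurable_compact cK.
apply: (integrable_support mD mK KD) => [x _ Kx|]; first by rewrite p0// mulr0.
rewrite (_ : (fun x => _) = ((EFin \o f) \* (EFin \o phi))%E) //.
apply: integrableMl => //; first exact: fi.
  exact: test_function_measurable tp.
have [M _ pM] := test_function_bounded tp.
exists M; split; first exact: num_real.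
by move=> y My x _; exact: le_trans (pM x) (ltW My).
Qed.

Lemma flat0_ge (t : R) : 0 < t -> 1 - t^-1 <= flat 0 t.
Proof. by move=> t0; rewrite /flat t0 mul1r expR_ge1Dx. Qed.

Lemma cvg_prod_seq (I : Type) (r : seq I) (F : I -> nat -> R) (l : I -> R) :
  (forall i, F i m @[m --> \oo] --> l i) ->
  \prod_(i <- r) F i m @[m --> \oo] --> \prod_(i <- r) l i.
Proof.
move=> Fl; elim: r => [|i r IH].
  by under eq_fun do rewrite big_nil; rewrite big_nil; exact: cvg_cst.
by under eq_fun do rewrite big_cons; rewrite big_cons; exact: cvgM.
Qed.

(** The boxes shrink more slowly than the bumps steepen, so that the limit is the
    indicator of the closed box, boundary included. *)
Definition box_approx a b (m : nat) : V -> R :=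
  box_bump (m.+1%:R ^+ 2) (a - const_mx m.+1%:R^-1) (b + const_mx m.+1%:R^-1).

Lemma cvg_flat_in (t : R) : 0 <= t ->
  flat 0 (m.+1%:R ^+ 2 * (t + m.+1%:R^-1)) @[m --> \oo] --> (1 : R).
Proof.
move=> t0; apply: (@squeeze_cvgr _ _ _ _ (fun m => 1 - m.+1%:R^-1) (cst 1)).
- apply: nearW => m; rewrite flat0_le1 andbT.
  have m0 : 0 < m.+1%:R :> R by rewrite ltr0n.
  have le_m : m.+1%:R <= m.+1%:R ^+ 2 * (t + m.+1%:R^-1) :> R.
    rewrite mulrDr expr2 -[X in _ <= _ + X]mulrA divff ?gt_eqF// mulr1 lerDr.
    by rewrite !mulr_ge0.
  apply: le_trans (flat0_ge (lt_le_trans m0 le_m)).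
  by rewrite lerB// lef_pV2 ?posrE//; exact: lt_le_trans le_m.
- rewrite -[X in _ --> X]subr0; apply: cvgB; first exact: cvg_cst.
  exact: cvg_harmonic.
- exact: cvg_cst.
Qed.

Lemma near_flat_out (t : R) : t < 0 ->
  \forall m \near \oo, flat 0 (m.+1%:R ^+ 2 * (t + m.+1%:R^-1)) = 0.
Proof.
move=> t0; have nt : 0 < - t by rewrite oppr_gt0.
have := near_infty_natSinv_lt (PosNum nt); apply: filterS => m /= mt.
rewrite flat_npos// pmulr_rle0 ?exprn_gt0 ?ltr0n//.
by rewrite -lerBrDl sub0r ltW.
Qed.

Lemma cvg_box_approx a b x :
  box_approx a b m x @[m --> \oo] --> (\1_(box a b) x : R).
Proof.
pose F i m :=
  flat 0 (m.+1%:R ^+ 2 * ((x ord0 i - a ord0 i) + m.+1%:R^-1)) *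
  flat 0 (m.+1%:R ^+ 2 * ((b ord0 i - x ord0 i) + m.+1%:R^-1)).
have E m : box_approx a b m x = \prod_(i < n) F i m.
  apply: eq_bigr => i _; rewrite !mxE; congr (flat 0 (_ * _) * flat 0 (_ * _)).
    by rewrite opprB addrA addrAC.
  by rewrite addrAC.
under eq_fun do rewrite E.
have [xb|] := pselect (box a b x).
  rewrite indicE mem_set//=.
  suff : \prod_(i < n) F i m @[m --> \oo] --> \prod_(i < n) (1 : R).
    by rewrite [in X in _ --> X -> _]big1.
  apply: (@cvg_prod_seq _ _ F (fun=> 1)) => i.
  suff : F i m @[m --> \oo] --> (1 * 1 : R) by rewrite mulr1.
  have := xb i; rewrite in_itv/= => /andP[ax bx].
  by apply: cvgM; apply: cvg_flat_in; rewrite subr_ge0.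
move=> xb; rewrite indicE memNset//=; apply: cvg_near_cst.
move: xb => /existsNP[i]; rewrite in_itv/= => /negP; rewrite negb_and -!ltNge.
case/orP => xi.
  have := @near_flat_out (x ord0 i - a ord0 i); rewrite subr_lt0 => /(_ xi).
  by apply: filterS => m m0; rewrite (bigD1 i)//= /F m0 !mul0r.
have := @near_flat_out (b ord0 i - x ord0 i); rewrite subr_lt0 => /(_ xi).
by apply: filterS => m m0; rewrite (bigD1 i)//= /F m0 mulr0 mul0r.
Qed.

Lemma box_approx_test W a b (d : R) m : box (a - const_mx d) (b + const_mx d) `<=` W ->
  m.+1%:R^-1 <= d -> test_function W (box_approx a b m).
Proof.
move=> abW md.
apply: (@supported_test_function _ _ _ (box (a - const_mx d) (b + const_mx d))) => //.
- exact: smooth_box_bump.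
- exact: compact_box.
- move=> x xb; apply: box_bump0; first by rewrite exprn_gt0// ltr0n.
  move=> xb'; apply: xb => i; have := xb' i; rewrite !in_itv/= !mxE => /andP[? ?].
  by apply/andP; split; [apply: le_trans; last eassumption|apply: le_trans; first eassumption];
    rewrite ?lerB ?lerD.
Qed.

Lemma fundamental_lemma_box W h a b (d : R) : open W -> locally_L1 W h ->
  (forall psi, test_function W psi -> \int[mu]_(x in W) (h x * psi x) = 0) ->
  0 < d -> box (a - const_mx d) (b + const_mx d) `<=` W ->
  (\int[mu]_(x in box a b) (h x)%:E = 0)%E.
Proof.
move=> oW hL h0 d0 abW; have mW := open_measurable_rV oW.
set Q := box (a - _) _ in abW.
have cQ : compact Q by exact: compact_box.
have mQ := measurable_compact cQ.
have abQ : box a b `<=` Q.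
  move=> x xb i; have := xb i; rewrite !in_itv/= !mxE => /andP[? ?].
  by apply/andP; split; lra.
have [m0 _ hm0] := near_infty_natSinv_lt (PosNum d0).
have tm m : test_function W (box_approx a b (m + m0)).
  by apply: (box_approx_test abW); apply/ltW/hm0; exact: leq_addl.
have hi := hL.2 _ cQ abW.
have int0 m : (\int[mu]_(x in Q) (h x * box_approx a b (m + m0) x)%:E = 0)%E.
  have := h0 _ (tm m); rewrite /Rintegral.
  have hmi := locally_L1_test_integrable mW hL (tm m).
  move/eqP; rewrite fine_eq0 ?integrable_fin_num// => /eqP.
  move=> H0; apply: etrans H0; rewrite [LHS]integral_mkcond [RHS]integral_mkcond.
  apply: eq_integral => x _; rewrite /patch; case: ifPn => [|].
    by rewrite inE => Qx; rewrite mem_set//; exact: abW.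
  rewrite notin_setE => Qx; case: ifP => // _.
  rewrite /box_approx box_bump0 ?mulr0// => xb.
  apply: Qx => i; have := xb i; rewrite !in_itv/= !mxE => /andP[? ?].
  have hd : (m + m0).+1%:R^-1 <= d by apply/ltW/hm0; exact: leq_addl.
  by apply/andP; split; [apply: le_trans (_ : a ord0 i - _ <= _); last eassumption|
    apply: le_trans (_ : _ <= b ord0 i + _); first eassumption];
    rewrite ?lerB ?lerD.
have := @dominated_cvg _ _ _ mu Q mQ
  (fun m x => (h x * box_approx a b (m + m0) x)%:E)
  (fun x => (h x * \1_(box a b) x)%:E) (fun x => `|(h x)%:E|%E).
move=> /(_ _ _ _ _ _) H.
have {}H : (\int[mu]_(x in Q) (h x * box_approx a b (m + m0) x)%:E)%E @[m --> \oo] -->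
    (\int[mu]_(x in Q) (h x * \1_(box a b) x)%:E)%E.
  apply: H => //.
  - move=> m; apply/measurable_EFinP; apply: measurable_funM.
      by apply: measurable_funS hL.1.
    exact: test_function_measurable (tm m).
  - move=> x Qx; apply: cvg_EFin; first exact: nearW.
    apply: cvgM; first exact: cvg_cst.
    by rewrite (cvg_shiftn m0 (fun m => box_approx a b m x)); exact: cvg_box_approx.
  - exact: integrable_abse.
  - move=> m x _; rewrite lee_fin normrM ler_piMr//.
    by rewrite ger0_norm ?box_bump_ge0// box_bump_le1.
move: H; under eq_fun do rewrite int0.
move=> /(cvg_unique (@ereal_hausdorff _) (cvg_cst _)) I0.
rewrite -(setIidr abQ) integral_mkcondr [RHS]I0; apply: eq_integral => x _.
by rewrite /patch indicE; case: ifP => _; rewrite ?mulr1 ?mulr0.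
Qed.

Lemma ae_forall_countable (I : countType) (P : I -> V -> Prop) :
  (forall i, {ae mu, forall x, P i x}) -> {ae mu, forall x, forall i, P i x}.
Proof.
move=> aP.
have : {ae mu, forall x, forall m, if unpickle m is Some i then P i x else True}.
  apply/ae_foralln => m; case: (unpickle m) => [i|]; first exact: aP.
  exact: aeW.
by apply: filterS => x Px i; have := Px (pickle i); rewrite pickleK.
Qed.

(** Testing against approximations of indicators shows that [h] has zero integral
    over small boxes. *)
Lemma fundamental_lemma W h : open W -> locally_L1 W h ->
  (forall psi, test_function W psi -> \int[mu]_(x in W) (h x * psi x) = 0) ->
  {ae mu, forall x, W x -> h x = 0}.
Proof.
move=> oW hL h0; have mW := open_measurable_rV oW.
pose C (z : 'rV[rat]_n * nat) : set V := cube (map_mx ratr z.1) z.2.+1%:R^-1.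
pose C2 (z : 'rV[rat]_n * nat) : set V := cube (map_mx ratr z.1) (z.2.+1%:R^-1 *+ 2).
have : {ae mu, forall x, forall z, C2 z `<=` W -> C z x -> h x = 0}.
  apply: ae_forall_countable => z.
  have [zW|] := pselect (C2 z `<=` W); last by move=> ?; apply: aeW => x /(_ _).
  have e0 : 0 < z.2.+1%:R^-1 :> R by rewrite invr_gt0 ltr0n.
  have [e eE] : exists e : R, e = z.2.+1%:R^-1 by eexists.
  have [q qE] : exists q : V, q = map_mx ratr z.1 by eexists.
  rewrite -eE in e0; move: zW; rewrite /C2 /C -eE -qE => zW.
  have CE : cube q e = box (q - const_mx e) (q + const_mx e).
    by rewrite cube_box// ltW.
  have CC2 : cube q e `<=` cube q (e *+ 2).
    by apply: cube_subset; rewrite mulr2n lerDl ltW.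
  pose g : V -> \bar R := (EFin \o h) \_ (cube q e).
  have mC : measurable (cube q e) by exact: measurable_cube.
  have gi : mu.-integrable setT g.
    apply/(integrable_mkcond _ mC); apply: hL.2; first exact: compact_cube.
    exact: subset_trans zW.
  have H : ae_eq mu setT g (cst 0%E).
    apply: ae_eq0_of_box_integrals => // a b.
    rewrite -integral_mkcondr CE boxI.
    apply: (@fundamental_lemma_box W _ _ _ e) => //.
    apply: subset_trans zW => x xb; apply: rV_norm_le; first by rewrite mulrn_wge0 ?ltW.
    move=> i; have := xb i; rewrite in_itv/= !mxE ler_norml => /andP[x1 x2].
    have [y1 y2] : q ord0 i - e <= Num.max (a ord0 i) (q ord0 i - e) /\
        Num.min (b ord0 i) (q ord0 i + e) <= q ord0 i + e.
      by rewrite le_max lexx orbT ge_min lexx orbT.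
    move: y1 y2 x1 x2; lra.
  apply: filterS H => x /(_ I) gx _ Cx.
  by move: gx; rewrite /g /patch mem_set//= => -[].
apply: filterS => x H Wx.
have [j0 /(_ _ (leqnn _)) [q [qx qU]]] := open_rat_cube oW Wx.
exact: (H (q, j0)).
Qed.

End fundamental_lemma.

(** * Weak derivatives *)

Section weak_derivatives.
Variables (R : realType) (n : nat).
Local Notation V := 'rV[R]_n.
Local Notation mu := (lebesgue_rV R n).
Local Notation e := (delta_mx ord0 : 'I_n -> V).
Implicit Types (f g phi psi : V -> R) (x v q a b : V) (s : seq 'I_n) (U K D Omega W : set V).

Lemma locally_L1S D W f : measurable W -> W `<=` D -> measurable D ->
  locally_L1 D f -> locally_L1 W f.
Proof.
move=> mW WD mD [mf fi]; split; first exact: measurable_funS mf.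
by move=> K cK KW; apply: fi => //; exact: subset_trans WD.
Qed.

Lemma locally_L1D D f g (c : R) : measurable D -> locally_L1 D f -> locally_L1 D g ->
  locally_L1 D (fun x => f x + c * g x).
Proof.
move=> mD [mf fi] [mg gi]; split.
  apply: measurable_funD => //; apply: measurable_funM => //.
move=> K cK KD; have mK := measurable_compact cK.
rewrite (_ : EFin \o _ = (EFin \o f) \+ (fun x => c%:E * (EFin \o g) x))%E //.
apply: integrableD => //; first exact: fi.
by apply: integrableZl => //; exact: gi.
Qed.

Lemma ae_bounded_integrable D f (M : R) : measurable D -> (mu D < +oo)%E ->
  measurable_fun D f -> {ae mu, forall x, D x -> `|f x| <= M} ->
  mu.-integrable D (EFin \o f).
Proof.
move=> mD Doo mf fM; apply/integrableP; split; first exact/measurable_EFinP.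
apply: (@le_lt_trans _ _ (\int[mu]_(x in D) `|M|%:E)%E).
  apply: ae_ge0_le_integral => //.
  - by apply: measurableT_comp => //; exact/measurable_EFinP.
  - apply: filterS fM => x /[swap] Dx /(_ Dx) fx.
    by rewrite /= lee_fin; apply: le_trans fx (ler_norm _).
by rewrite integral_cst// lte_mul_pinfty ?lee_fin.
Qed.

Lemma locally_L1_ae_bounded D f (M : R) : measurable D -> measurable_fun D f ->
  {ae mu, forall x, D x -> `|f x| <= M} -> locally_L1 D f.
Proof.
move=> mD mf fM; split=> // K cK KD; have mK := measurable_compact cK.
have mfK : measurable_fun K f by exact: measurable_funS mf.
apply: (ae_bounded_integrable mK (lebesgue_compact_fin cK) mfK (M := M)).
by apply: filterS fM => x fx Kx; exact: fx (KD _ Kx).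
Qed.

Lemma continuous_locally_L1 D f : measurable D -> continuous f -> locally_L1 D f.
Proof.
move=> mD cf; have mf := continuous_measurable_rV cf.
split=> [|K cK _]; first exact: measurable_funTS.
apply: measurable_bounded_integrable.
- exact: measurable_compact.
- exact: lebesgue_compact_fin.
- exact: measurable_funTS.
- have : bounded_set (f @` K).
    by apply: compact_bounded; apply: continuous_compact => //; exact: continuous_subspaceT.
  move=> [M [Mr fM]]; exists M; split=> // y My x Kx.
  by apply: (fM y My); exists x.
Qed.

Lemma Rintegral_supported D W f : W `<=` D ->
  (forall x, D x -> ~ W x -> f x = 0) ->
  \int[mu]_(x in D) f x = \int[mu]_(x in W) f x.
Proof.
move=> WD f0; rewrite Rintegral_mkcond [RHS]Rintegral_mkcond.
apply: eq_Rintegral => x _; rewrite /patch.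
case: ifPn => [|]; rewrite ?inE ?notin_setE => Dx.
  by case: ifPn => //; rewrite notin_setE => /f0 ->.
by rewrite ifF//; apply/negP; rewrite inE => /WD.
Qed.

Lemma test_function_out D psi x : test_function D psi -> ~ D x -> psi x = 0.
Proof.
move=> tp Dx; have [K [_ KD ->]] := test_function_support tp => //.
by move=> /KD.
Qed.

Lemma integral_by_parts D f psi i : open D -> smooth f -> test_function D psi ->
  \int[mu]_(x in D) (f x * 'D_(e i) psi x) =
  - \int[mu]_(x in D) ('D_(e i) f x * psi x).
Proof.
move=> oD sf tp; have mD := open_measurable_rV oD.
have tdp : test_function D (fun x => 'D_(e i) psi x) := pderiv_test [:: i] tp.
have sdf : smooth (fun x => 'D_(e i) f x) := smooth_pderiv [:: i] sf.
have sp := test_function_smooth tp.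
have i1 := locally_L1_test_integrable mD
  (continuous_locally_L1 mD (smooth_continuous sf)) tdp.
have i2 := locally_L1_test_integrable mD
  (continuous_locally_L1 mD (smooth_continuous sdf)) tp.
apply/eqP; rewrite -addr_eq0 -RintegralD//; apply/eqP.
have DE x : 'D_(e i) (fun y => f y * psi y) x =
    f x * 'D_(e i) psi x + 'D_(e i) f x * psi x.
  rewrite deriveM; first by rewrite /GRing.scale/= [psi x * _]mulrC.
    by have [_] := sf [::].
  by have [_] := sp [::].
under eq_Rintegral do rewrite -DE.
have tM := test_functionM sf tp.
rewrite -(@Rintegral_supported setT)//; last first.
  move=> x _ Dx; rewrite DE (test_function_out tp Dx) mulr0 addr0.
  by rewrite (test_function_out tdp Dx) mulr0.
by rewrite /Rintegral (integral_derive i tM).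
Qed.

(** Reversing the list of directions avoids appealing to the symmetry of
    iterated derivatives. *)
Lemma smooth_weak_deriv Omega s f : open Omega -> smooth f ->
  is_weak_deriv Omega s f (pderiv (rev s) f).
Proof.
move=> oO sf; have mO := open_measurable_rV oO.
split.
- exact: continuous_locally_L1 (smooth_continuous sf).
- by apply: continuous_locally_L1 => //; apply: smooth_continuous; exact: smooth_pderiv.
- elim: s f sf => [|i s IH] f sf psi tp; first by rewrite mul1r.
  rewrite /= (integral_by_parts _ oO sf (pderiv_test s tp)) IH//.
    by rewrite rev_cons pderiv_rcons exprS mulN1r mulNr.
  exact: (smooth_pderiv [:: i] sf).
Qed.

Lemma is_weak_derivD Omega s f g f' g' (c : R) : open Omega ->
  is_weak_deriv Omega s f g -> is_weak_deriv Omega s f' g' ->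
  is_weak_deriv Omega s (fun x => f x + c * f' x) (fun x => g x + c * g' x).
Proof.
move=> oO [lf lg fg] [lf' lg' fg']; have mO := open_measurable_rV oO.
split; [exact: locally_L1D|exact: locally_L1D|] => phi tp.
have tsp := pderiv_test s tp.
have E (h h' chi : V -> R) : locally_L1 Omega h -> locally_L1 Omega h' ->
    test_function Omega chi ->
    \int[mu]_(x in Omega) ((h x + c * h' x) * chi x) =
    \int[mu]_(x in Omega) (h x * chi x) + c * \int[mu]_(x in Omega) (h' x * chi x).
  move=> lh lh' tchi; have ih := locally_L1_test_integrable mO lh tchi.
  have ih' := locally_L1_test_integrable mO lh' tchi.
  rewrite -RintegralZl// -RintegralD//.
    by apply: eq_Rintegral => x _; rewrite mulrDl mulrA.
  exact: (integrableZl mO c ih').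
by rewrite !E// fg// fg'// mulrDr mulrCA.
Qed.

(** For [W = Omega] this is the uniqueness of weak derivatives. *)
Lemma weak_deriv_local Omega W s f g f' g' : open Omega -> open W -> W `<=` Omega ->
  is_weak_deriv Omega s f g -> is_weak_deriv Omega s f' g' ->
  {ae mu, forall x, W x -> f x = f' x} -> {ae mu, forall x, W x -> g x = g' x}.
Proof.
move=> oO oW WO wf wf' ff'.
have [lf lg fg] := is_weak_derivD (-1) oO wf wf'.
have mO := open_measurable_rV oO; have mW := open_measurable_rV oW.
have lfW := locally_L1S mW WO mO lf; have lgW := locally_L1S mW WO mO lg.
have := fundamental_lemma oW lgW.
suff H : forall psi, test_function W psi ->
    \int[mu]_(x in W) ((g x + -1 * g' x) * psi x) = 0.
  move=> /(_ H); apply: filterS => x /[apply] /eqP.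
  by rewrite mulN1r subr_eq0 => /eqP.
move=> psi tp; have tpO := test_functionS WO tp.
have := fg _ tpO.
rewrite (Rintegral_supported WO); last first.
  by move=> x _ Wx; rewrite (test_function_out (pderiv_test s tp) Wx) mulr0.
rewrite [X in _ = _ * X -> _](Rintegral_supported WO); last first.
  by move=> x _ Wx; rewrite (test_function_out tp Wx) mulr0.
suff -> : \int[mu]_(x in W) ((f x + -1 * f' x) * pderiv s psi x) = 0.
  by move=> /esym/eqP; rewrite mulrI_eq0; [move/eqP|exact/lregX/lregN/lreg1].
rewrite /Rintegral (@ae_eq_integral _ _ _ _ _ (cst 0%E)) ?integral0//.
- apply/measurable_EFinP; apply: measurable_funM; first exact: lfW.1.
  exact: test_function_measurable (pderiv_test s tp).
- apply: filterS ff' => x ff' Wx /=.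
  by rewrite (ff' Wx) mulN1r subrr mul0r.
Qed.

Lemma weak_deriv_lim Omega s f g (F G : nat -> V -> R) (M : R) : open Omega ->
  (forall m, is_weak_deriv Omega s (F m) (G m)) ->
  measurable_fun Omega f -> measurable_fun Omega g ->
  {ae mu, forall x, Omega x -> forall m, `|F m x| <= M /\ `|G m x| <= M} ->
  {ae mu, forall x, Omega x -> F m x @[m --> \oo] --> f x /\ G m x @[m --> \oo] --> g x} ->
  is_weak_deriv Omega s f g.
Proof.
move=> oO wFG mf mg FGM FGfg; have mO := open_measurable_rV oO.
have lim (H : nat -> V -> R) (h chi : V -> R) : (forall m, locally_L1 Omega (H m)) ->
    measurable_fun Omega h ->
    {ae mu, forall x, Omega x -> forall m, `|H m x| <= M} ->
    {ae mu, forall x, Omega x -> H m x @[m --> \oo] --> h x} ->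
    test_function Omega chi ->
    \int[mu]_(x in Omega) (H m x * chi x) @[m --> \oo] -->
    \int[mu]_(x in Omega) (h x * chi x).
  move=> lH mh HM Hh tchi.
  have mchi := @test_function_measurable _ _ _ _ Omega tchi.
  have [] := @dominated_convergence _ _ _ mu Omega mO
    (fun m x => (H m x * chi x)%:E) (fun x => (h x * chi x)%:E)
    (fun x => (M * `|chi x|)%:E).
  - by move=> m; apply/measurable_EFinP; apply: measurable_funM => //; exact: (lH m).1.
  - by apply/measurable_EFinP; apply: measurable_funM.
  - apply: filterS Hh => x /[apply] Hx; apply: cvg_EFin; first exact: nearW.
    by apply: cvgM => //; exact: cvg_cst.
  - suff : mu.-integrable Omega (abse \o (EFin \o chi)) by exact: integrableZl.
    have := integrableS measurableT mO (@subsetT _ _) (test_function_integrable tchi).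
    by move=> /integrable_abse.
  - apply: filterS HM => x Hx m Ox; rewrite lee_fin normrM.
    by rewrite ler_wpM2r//; exact: Hx.
  by move=> hi _ C; apply: fine_cvg; rewrite fineK// integrable_fin_num.
have ae_b (h : V -> R) (H : nat -> V -> R) :
    {ae mu, forall x, Omega x -> forall m, `|H m x| <= M} ->
    {ae mu, forall x, Omega x -> H m x @[m --> \oo] --> h x} ->
    {ae mu, forall x, Omega x -> `|h x| <= M}.
  apply: filterS2 => x HM Hh Ox.
  have {}Hh : `|H m x| @[m --> \oo] --> `|h x| by apply: cvg_norm; exact: Hh.
  have <- := cvg_lim (@norm_hausdorff _ _) Hh.
  apply: limr_le; first by apply/cvg_ex; eexists; exact: Hh.
  by apply: nearW => m; exact: HM.
have FM : {ae mu, forall x, Omega x -> forall m, `|F m x| <= M}.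
  by apply: filterS FGM => x /[apply] H m; have [] := H m.
have GM : {ae mu, forall x, Omega x -> forall m, `|G m x| <= M}.
  by apply: filterS FGM => x /[apply] H m; have [] := H m.
have Ff : {ae mu, forall x, Omega x -> F m x @[m --> \oo] --> f x}.
  by apply: filterS FGfg => x /[apply] -[].
have Gg : {ae mu, forall x, Omega x -> G m x @[m --> \oo] --> g x}.
  by apply: filterS FGfg => x /[apply] -[].
split; [exact: locally_L1_ae_bounded (ae_b _ _ FM Ff)|
        exact: locally_L1_ae_bounded (ae_b _ _ GM Gg)|] => phi tp.
have C1 := lim F f _ (fun m => let: And3 h _ _ := wFG m in h) mf FM Ff (pderiv_test s tp).
have C2 := lim G g _ (fun m => let: And3 _ h _ := wFG m in h) mg GM Gg tp.
have {}C2 : (-1) ^+ size s * \int[mu]_(x in Omega) (G m x * phi x) @[m --> \oo] -->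
    (-1) ^+ size s * \int[mu]_(x in Omega) (g x * phi x).
  by apply: cvgM => //; exact: cvg_cst.
apply: (cvg_unique (@norm_hausdorff _ _) C1).
apply: cvg_trans C2; apply: near_eq_cvg; apply: nearW => m.
by have [_ _ /(_ _ tp) ->] := wFG m.
Qed.

(** With a cutoff [chi] equal to 1 near [K], testing [phi] against [psi] or against
    [chi * psi] makes no difference, and the latter is a test function on [U]. *)
Lemma weak_deriv_extend Omega U K s phi g : open Omega -> open U -> U `<=` Omega ->
  compact K -> K `<=` U -> (forall x, ~ K x -> phi x = 0) ->
  is_weak_deriv U s phi g -> exists G, is_weak_deriv Omega s phi G.
Proof.
move=> oO oU UO cK KU phi0 [lp lg pg].
have mO := open_measurable_rV oO; have mU := open_measurable_rV oU.
have [chi [W [tchi oW KW chi1]]] := exists_cutoff cK oU KU.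
have [S [cS SU chi0]] := test_function_support tchi.
have mS := measurable_compact cS; have mK := measurable_compact cK.
have ext h S' : compact S' -> S' `<=` U -> measurable_fun U h ->
    mu.-integrable S' (EFin \o h) -> (forall x, ~ S' x -> h x = 0) ->
    locally_L1 Omega h.
  move=> cS' SU' mh hi h0; have mS' := measurable_compact cS'.
  have hE : h = h \_ U.
    apply/funext => x; rewrite /patch; case: ifPn => //.
    by rewrite notin_setE => Ux; apply: h0 => /SU'.
  split; first by rewrite hE; apply: measurable_funTS; apply/(measurable_restrictT _ mU).
  move=> K' cK' K'O; apply: (@integrableS _ _ _ mu setT) => //.
    exact: measurable_compact.
  by apply: (integrable_support measurableT mS') => // x _ Sx; rewrite /= h0.
exists ((fun x => g x * chi x) \_ U); split.
- apply: (ext _ K) => //; first exact: lp.1.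
  exact: lp.2.
- apply: (ext _ S) => //.
  + apply: (eq_measurable_fun (fun x => g x * chi x)).
      by move=> x xU; rewrite /patch xU.
    by apply: measurable_funM; [exact: lg.1|exact: test_function_measurable tchi].
  + have gi := integrableS mU mS SU (locally_L1_test_integrable mU lg tchi).
    apply: eq_integrable gi => // x; rewrite inE => Sx /=.
    by rewrite /patch mem_set//; exact: SU.
  + by move=> x Sx; rewrite /patch; case: ifP => // _; rewrite chi0// mulr0.
- move=> psi tp; have tcp : test_function U (chi \* psi).
    rewrite (_ : chi \* psi = psi \* chi); last by apply/funext => x /=; rewrite mulrC.
    by apply: test_functionM => //; exact: test_function_smooth tp.
  rewrite (Rintegral_supported UO); last first.
    by move=> x _ Ux; rewrite phi0 ?mul0r// => /KU.
  rewrite [in RHS](Rintegral_supported UO); last first.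
    by move=> x _ Ux; rewrite /patch memNset// mul0r.
  transitivity (\int[mu]_(x in U) (phi x * pderiv s (chi \* psi) x)).
    apply: eq_Rintegral => x _; have [Kx|/phi0 ->] := pselect (K x); last by rewrite !mul0r.
    congr (_ * _); apply: (@pderiv_local _ _ s psi (chi \* psi) W) => //.
      2: by rewrite inE; exact: KW.
    by move=> y Wy /=; rewrite chi1// mul1r.
  rewrite pg//; congr (_ * _); apply: eq_Rintegral => x xU.
  by rewrite /patch xU mulrA.
Qed.

End weak_derivatives.

(** * Consequences of the structure conditions *)

Section jet_norms.
Variables (R : realType) (n N k : nat).
Local Notation J := (jet_space R n N k).
Implicit Types X : J.

Lemma jet_norm_ge0 X : 0 <= jet_norm X.
Proof. exact: sqrtr_ge0. Qed.

Lemma norm_le_jet_norm X : `|X| <= jet_norm X.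
Proof.
apply: rV_norm_le; first exact: jet_norm_ge0.
move=> i; rewrite -sqrtr_sqr; apply: ler_wsqrtr.
by rewrite (bigD1 i)//= lerDl; apply: sumr_ge0 => j _; exact: sqr_ge0.
Qed.

Definition norm_ratio : R := #|{: jet_index n N k}|.+1%:R.

Lemma norm_ratio_gt0 : 0 < norm_ratio.
Proof. by rewrite ltr0n. Qed.

Lemma jet_norm_le_norm X : jet_norm X <= norm_ratio * `|X|.
Proof.
have c0 := ltW norm_ratio_gt0.
rewrite -[leRHS]ger0_norm ?mulr_ge0// -sqrtr_sqr; apply: ler_wsqrtr.
apply: (@le_trans _ _ (\sum_(i < #|{: jet_index n N k}|) `|X| ^+ 2)).
  apply: ler_sum => i _; rewrite -(ger0_norm (sqr_ge0 _)) normrX.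
  by apply: lerXn2r; rewrite ?nnegrE//; exact: ler_coord_norm.
rewrite sumr_const card_ord exprMn -mulr_natl ler_wpM2r ?sqr_ge0//.
rewrite /norm_ratio -natrX ler_nat expnS expn1.
by rewrite (leq_trans (leqnSn _))// leq_pmulr.
Qed.

Lemma jet_normZ (t : R) X : 0 <= t -> jet_norm (t *: X) = t * jet_norm X.
Proof.
move=> t0; rewrite /jet_norm -[in RHS](ger0_norm t0) -sqrtr_sqr -sqrtrM ?sqr_ge0//.
by congr Num.sqrt; rewrite mulr_sumr; apply: eq_bigr => i _; rewrite mxE exprMn.
Qed.

End jet_norms.

Section structure_conditions.
Variables (R : realType) (n N k : nat).
Local Notation V := 'rV[R]_n.
Local Notation J := (jet_space R n N k).
Local Notation mu := (lebesgue_rV R n).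
Variables (Omega : set V) (Omega_open : open Omega) (H : V -> J -> R).
Hypothesis H_ge0 : forall x X, Omega x -> 0 <= H x X.
Hypothesis H_cont : {within Omega `*` [set: J], continuous (fun z => H z.1 z.2)}.
Hypothesis H_0 : forall x, Omega x -> H x 0 = 0.

Lemma H_continuous_left X : {within Omega, continuous (fun x => H x X)}.
Proof.
rewrite continuous_open_subspace// => x; rewrite inE => Ox.
have oOJ : open (Omega `*` [set: J]).
  rewrite openE => z [Oz _]; exists (Omega, setT) => //=.
  by split; [exact: open_nbhs_nbhs|exact: filterT].
move: H_cont; rewrite continuous_open_subspace// => /(_ (x, X)).
rewrite inE => /(_ (conj Ox I)) C.
apply: (@continuous_comp _ _ _ (fun x => (x, X)) (fun z => H z.1 z.2)) => //.
move=> A [[P Q] /= [Px QX] PQA].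
rewrite nbhs_simpl/=; apply: filterS Px => y Py; apply: PQA; split=> //=.
exact: nbhs_singleton QX.
Qed.

Lemma H_continuous_left_diff X X' :
  {within Omega, continuous (fun x => H x X - H x X')}.
Proof. by move=> x; apply: continuousB; exact: H_continuous_left. Qed.

(** Continuity in [x] removes the exceptional null sets, which may depend on [t]
    and [X]. The lower bound on unit jets is the loss incurred from [X] to [X / 2],
    as [H] is nonnegative. *)
Lemma H_scaling : (exists c : R -> R -> R,
    [/\ {within `[0, 1] `*` `[0, +oo[, continuous (fun z : R * R => c z.1 z.2)},
      (forall t r, 0 <= t <= 1 -> 0 <= r -> 0 <= c t r),
      (forall r, 0 <= r -> c 1 r = 0),
      (forall t, 0 <= t <= 1 -> c t 0 = 0) &
      (forall t r, 0 < t < 1 -> 0 < r -> 0 < c t r) /\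
      (forall t X, 0 <= t <= 1 -> {ae mu, forall x, Omega x ->
           H x (t *: X) <= H x X - c t (jet_norm X)})]) ->
  (forall x, Omega x -> forall t X, 0 <= t <= 1 -> H x (t *: X) <= H x X) /\
  exists2 c0 : R, 0 < c0 &
    forall x, Omega x -> forall X, jet_norm X = 1 -> c0 <= H x X.
Proof.
move=> [c [_ c_ge0 _ _ [c_gt0 Hc]]].
have Hc' t X : 0 <= t <= 1 -> forall x, Omega x ->
    H x (t *: X) - H x X <= - c t (jet_norm X).
  move=> t01; apply: ae_on_open => //; first exact: H_continuous_left_diff.
  by apply: filterS (Hc t X t01) => x /[apply]; lra.
split=> [x Ox t X t01|].
  have := Hc' t X t01 x Ox; have := c_ge0 t _ t01 (jet_norm_ge0 X); lra.
exists (c 2^-1 1); first by apply: c_gt0 => //; lra.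
move=> x Ox X X1; have t01 : 0 <= (2^-1 : R) <= 1 by lra.
have := Hc' 2^-1 X t01 x Ox; rewrite X1.
have := H_ge0 (2^-1 *: X) Ox; lra.
Qed.

Hypothesis H_modulus : forall rho, 0 < rho -> exists omega : R -> R,
  [/\ {within `]0, +oo[, continuous omega},
      (forall r r', 0 < r -> r <= r' -> omega r <= omega r'),
      omega r @[r --> 0^'+] --> 0 &
      {ae mu, forall x, Omega x ->
        forall X X', jet_norm X <= rho -> jet_norm X' <= rho -> X != X' ->
          `|H x X - H x X'| <= omega (jet_norm (X - X'))}].

Lemma H_unif_cont (rho eps : R) : 0 < rho -> 0 < eps -> exists2 d : R, 0 < d &
  forall x, Omega x -> forall X X', `|X| <= rho -> `|X'| <= rho -> `|X - X'| <= d ->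
    `|H x X - H x X'| <= eps.
Proof.
move=> rho0 eps0; pose c : R := norm_ratio R n N k.
have c0 : 0 < c by exact: norm_ratio_gt0.
have crho : 0 < c * rho by rewrite mulr_gt0.
have [omega [_ omega_nd omega0 Hom]] := H_modulus crho.
have [r0 r0_gt0 omr0] : exists2 r0, 0 < r0 & omega r0 <= eps.
  have ev : \forall r \near (0 : R)^'+, omega r <= eps.
    have : \forall r \near (0 : R)^'+, omega r < eps by apply: (cvgr_lt 0).
    by apply: filterS => r /ltW.
  near (0 : R)^'+ => r; exists r; first by near: r; exact: nbhs_right_gt.
  by near: r.
exists (r0 / c); first by rewrite divr_gt0.
move=> x Ox X X' Xr X'r XX'.
have [->|XnX'] := eqVneq X X'; first by rewrite subrr normr0 ltW.
have jX (Y : J) : `|Y| <= rho -> jet_norm Y <= c * rho.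
  by move=> Yr; apply: le_trans (jet_norm_le_norm Y) _; rewrite ler_wpM2l// ltW.
have {}omr0 : omega (jet_norm (X - X')) <= eps.
  apply: le_trans omr0; apply: omega_nd.
    by apply: lt_le_trans (norm_le_jet_norm _); rewrite normr_gt0 subr_eq0.
  apply: le_trans (jet_norm_le_norm _) _.
  by rewrite mulrC -ler_pdivlMr.
apply: (@ae_on_open _ _ Omega (fun x => `|H x X - H x X'|)) Ox => //.
  move=> z; apply: (@continuous_comp (subspace Omega) R R
    (fun x => H x X - H x X') Num.norm); first exact: H_continuous_left_diff.
  exact: norm_continuous.
apply: filterS Hom => z /[apply] /(_ X X' (jX _ Xr) (jX _ X'r) XnX').
by move=> /le_trans; apply.
Unshelve. all: by end_near. Qed.

(** The modulus of continuity, starting from [H x 0 = 0]. *)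
Lemma H_bounded (rho : R) : exists C : R,
  forall x, Omega x -> forall X, `|X| <= rho -> H x X <= C.
Proof.
pose c : R := norm_ratio R n N k.
have c0 : 0 < c by exact: norm_ratio_gt0.
have r0 : 0 < c * (`|rho| + 1) by rewrite mulr_gt0// ltr_wpDl.
have [omega [_ omega_nd omega0 Hom]] := H_modulus r0.
exists (Num.max 0 (omega (c * (`|rho| + 1)))) => x Ox X Xr.
have [->|X0] := eqVneq X 0; first by rewrite H_0// le_max lexx.
rewrite le_max; apply/orP; right.
have jX : jet_norm X <= c * (`|rho| + 1).
  apply: le_trans (jet_norm_le_norm X) _; apply: ler_wpM2l; first exact: ltW.
  by apply: (le_trans Xr); rewrite (le_trans (ler_norm _))// lerDl.
apply: (@ae_on_open _ _ Omega (fun x => H x X)) Ox => //.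
  exact: H_continuous_left.
apply: filterS Hom => z + Oz => /(_ Oz X 0 jX); rewrite subr0 H_0// subr0.
have -> : jet_norm (0 : J) = 0.
  by rewrite -(scale0r (0 : J)) jet_normZ// mul0r.
move=> /(_ (ltW r0) X0); rewrite ger0_norm ?H_ge0// => /le_trans; apply.
apply: omega_nd => //; apply: lt_le_trans (norm_le_jet_norm _).
by rewrite normr_gt0.
Qed.

Hypothesis H_mono : forall x, Omega x -> forall t X, 0 <= t <= 1 -> H x (t *: X) <= H x X.
Variables (c0 : R) (c0_gt0 : 0 < c0).
Hypothesis H_unit : forall x, Omega x -> forall X, jet_norm X = 1 -> c0 <= H x X.
Hypothesis H_convex : forall x X, Omega x -> convex_function (same_lower_order X) (H x).

(** Convexity turns the positive lower bound on unit jets of pure top order into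
    linear growth. *)
Lemma H_top_growth x X : Omega x -> same_lower_order 0 X -> 1 <= jet_norm X ->
  c0 * jet_norm X <= H x X.
Proof.
move=> Ox X0 X1; have Xgt0 : 0 < jet_norm X by exact: lt_le_trans X1.
have t0 : 0 <= (jet_norm X)^-1 by rewrite invr_ge0 ltW.
have t1 : (jet_norm X)^-1 <= 1 by rewrite invf_le1.
have U : jet_norm ((jet_norm X)^-1 *: X) = 1.
  by rewrite jet_normZ// mulVf// gt_eqF.
have X00 : same_lower_order (0 : J) 0 by move=> i _; rewrite mxE.
have := @H_convex x 0 Ox (Itv01 t0 t1) X 0 (mem_set X0) (mem_set X00).
have -> : @conv R (convex_lmodType J) (Itv01 t0 t1) X 0 = (jet_norm X)^-1 *: X.
  by rewrite /conv/= scaler0 addr0.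
rewrite convRE/= H_0// mulr0 addr0 => HX.
have := le_trans (H_unit Ox U) HX.
by rewrite mulrC ler_pdivlMr.
Qed.

Definition top_part (X : J) : J :=
  \row_i if (tag (enum_val i : jet_index n N k) < k)%N then 0 else X ord0 i.

(** Sublevel sets of [H x] over bounded lower-order parts are bounded: scaling a
    jet down pushes its lower-order part to zero while a pure top-order jet of
    prescribed size remains, to which linear growth applies. *)
Lemma H_coercive (M C : R) : exists2 S : R, 0 < S &
  forall x, Omega x -> forall X : J,
    (forall i : jet_index n N k, (tag i < k)%N -> `|X ord0 (enum_rank i)| <= M) ->
    H x X <= C -> `|X| <= S.
Proof.
pose r : R := Num.max 1 ((C + 2) / c0).
have r1 : 1 <= r by rewrite le_max lexx.
have r0 : 0 < r by exact: lt_le_trans r1.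
have rC : C + 2 <= c0 * r.
  by rewrite mulrC -ler_pdivrMr// le_max lexx orbT.
have r10 : 0 < r + 1 by rewrite addr_gt0.
have [d0 d0_gt0 Hd] := H_unif_cont r10 ltr01.
pose d := Num.min d0 1.
have d_gt0 : 0 < d by rewrite lt_min d0_gt0 ltr01.
pose M' := `|M| + 1.
have M'0 : 0 < M' by rewrite ltr_wpDl.
pose S0 := Num.max r (r * M' / d).
exists (M' + S0); first by rewrite addr_gt0// lt_max r0.
move=> x Ox X Xlow HX; pose T := top_part X; pose L := X - T.
have LM : `|L| <= M'.
  apply: rV_norm_le => [|i]; first exact: ltW.
  rewrite !mxE; case: ifPn => ik; last by rewrite subrr normr0 ltW.
  rewrite subr0 -[i]enum_valK; apply: (le_trans (Xlow _ ik)).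
  by rewrite (le_trans (ler_norm _))// lerDl.
have [TS|ST] := leP `|T| S0.
  have -> : X = L + T by rewrite subrK.
  by apply: (le_trans (ler_normD _ _)); rewrite lerD.
exfalso; have T0 : 0 < `|T| by apply: lt_trans ST; rewrite lt_max r0.
have rT : r <= `|T| by apply: ltW; apply: le_lt_trans ST; rewrite le_max lexx.
pose t := r / `|T|.
have t0 : 0 <= t by rewrite divr_ge0// ltW.
have t01 : 0 <= t <= 1 by rewrite t0 ler_pdivrMr// mul1r.
have tT : `|t *: T| = r by rewrite normrZ ger0_norm// divfK// gt_eqF.
have tXT : `|t *: X - t *: T| <= d.
  rewrite -scalerBr normrZ ger0_norm//.
  apply: (@le_trans _ _ (t * M')); first by rewrite ler_wpM2l.
  rewrite /t mulrAC ler_pdivrMr// [leRHS]mulrC -ler_pdivrMr//.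
  by apply: ltW; apply: le_lt_trans ST; rewrite le_max lexx orbT.
have tX : `|t *: X| <= r + 1.
  have -> : t *: X = t *: T + (t *: X - t *: T) by rewrite addrC subrK.
  apply: (le_trans (ler_normD _ _)); rewrite tT lerD2l.
  by apply: (le_trans tXT); rewrite ge_min lexx orbT.
have jT : r <= jet_norm (t *: T) by rewrite -tT; exact: norm_le_jet_norm.
have TT : same_lower_order 0 (t *: T).
  by move=> i ik; rewrite !mxE enum_rankK ik mulr0.
have G := H_top_growth Ox TT (le_trans r1 jT).
have := Hd x Ox (t *: X) (t *: T) tX _ _.
rewrite tT lerDl ler01 => /(_ isT); rewrite (le_trans tXT) ?ge_min ?lexx//.
move=> /(_ isT); rewrite ler_norml => /andP[+ _].
have := H_mono Ox X t01.
have : c0 * r <= c0 * jet_norm (t *: T) by apply: ler_wpM2l => //; exact: ltW.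
move: G rC HX; lra.
Qed.

End structure_conditions.

(** * Sobolev maps and their jets *)

Section memLp.
Variables (R : realType) (n : nat).
Local Notation V := 'rV[R]_n.
Local Notation mu := (lebesgue_rV R n).
Implicit Types (f g : V -> R) (Omega D : set V).

Lemma lebesgue_setT_gt0 : (0 < mu setT)%E.
Proof.
rewrite lt0e measure_ge0 andbT; apply/negP => /eqP mu0.
apply: (@open_not_negligible R n setT openT); first by exists 0.
by apply/negligibleP.
Qed.

Lemma memLoo_bounded Omega f : measurable Omega -> memLp Omega +oo%E f ->
  measurable_fun Omega f /\
  exists M : R, {ae mu, forall x, Omega x -> `|f x| <= M}.
Proof.
move=> mO fL; have mf := sub_Lfun_mfun fL; have := sub_Lfun_finLfun fL.
rewrite inE /= /finite_norm unlock /= lebesgue_setT_gt0 => fM.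
split; first by apply/(measurable_restrictT _ mO); move: mf; rewrite inE.
have [y yf yoo] := ereal_inf_lt fM.
exists (fine y); apply: filterS yf => x + Ox /=.
rewrite /= patchT ?inE//; case: y yoo => [r|//|] _ /=; first by rewrite lee_fin.
by rewrite leNgt ltNyr.
Qed.

Lemma bounded_memLoo Omega f (M : R) : measurable Omega -> measurable_fun Omega f ->
  {ae mu, forall x, Omega x -> `|f x| <= M} -> memLp Omega +oo%E f.
Proof.
move=> mO mf fM; apply/andP; split.
  by rewrite inE; apply/(measurable_restrictT _ mO).
rewrite inE /= /finite_norm unlock /= lebesgue_setT_gt0.
apply: (@le_lt_trans _ _ `|M|%:E); last exact: ltry.
apply: ereal_inf_lbound => /=; apply: filterS fM => x fx /=.
rewrite lee_fin /= /patch; case: ifPn => [|_]; last by rewrite normr0.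
by rewrite inE => /fx /le_trans; apply; exact: ler_norm.
Qed.

Lemma integrable_memL1 Omega f : measurable Omega ->
  mu.-integrable Omega (EFin \o f) -> memLp Omega 1%E f.
Proof.
move=> mO fi; apply/andP; split.
  by rewrite inE; apply/(measurable_restrictT _ mO)/measurable_EFinP; case/integrableP: fi.
rewrite inE /= /finite_norm Lnorm1.
move: fi => /(integrable_mkcond _ mO); rewrite -restrict_EFin => /integrableP[_].
by [].
Qed.

Lemma Lnorm1_le Omega f (B : R) (A : set V) : measurable Omega ->
  measurable_fun Omega f -> measurable A -> 0 <= B ->
  {ae mu, forall x, Omega x -> `|f x| <= B} ->
  {ae mu, forall x, Omega x -> ~ A x -> f x = 0} ->
  ('N[mu]_1[EFin \o (f \_ Omega)] <= B%:E * mu A)%E.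
Proof.
move=> mO mf mA B0 fB fA.
rewrite Lnorm1 -integral_cst//.
rewrite [leRHS]integral_mkcond; apply: ae_ge0_le_integral => //.
- apply: measurableT_comp => //; apply/measurable_EFinP.
  by apply/(measurable_restrictT _ mO).
- by move=> x _; rewrite /patch; case: ifP.
- by apply/(measurable_restrictT _ mA); exact: measurable_cst.
- apply: filterS2 fB fA => x fBx fAx _ /=; rewrite /patch.
  case: ifPn => [|_]; last by rewrite normr0; case: ifP.
  rewrite inE => Ox; case: ifPn => [_|]; first by rewrite lee_fin fBx.
  by rewrite notin_setE => Ax; rewrite fAx// normr0.
Qed.

End memLp.

Section jets.
Variables (R : realType) (n N k : nat).
Local Notation V := 'rV[R]_n.
Local Notation J := (jet_index n N k).
Local Notation mu := (lebesgue_rV R n).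
Implicit Types (Omega : set V) (u v : V -> 'rV[R]_N) (X : V -> jet_space R n N k).

Definition comp_of u (a : 'I_N) : V -> R := fun x => u x ord0 a.

(** Any representative is allowed, whereas [jet] makes a choice. *)
Definition is_jet Omega u X := forall i : J,
  is_weak_deriv Omega (tagged i).2 (comp_of u (tagged i).1)
    (fun x => X x ord0 (enum_rank i)).

Lemma jetE Omega u x (i : J) : jet k Omega u x ord0 (enum_rank i) =
  weak_deriv Omega (tagged i).2 (comp_of u (tagged i).1) x.
Proof. by rewrite mxE enum_rankK. Qed.

Lemma is_jet_jet Omega u :
  (forall i : J, exists g, is_weak_deriv Omega (tagged i).2 (comp_of u (tagged i).1) g) ->
  is_jet Omega u (jet k Omega u).
Proof.
move=> wu i; under [X in is_weak_deriv _ _ _ X]eq_fun do rewrite jetE.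
exact: (xgetPex _ (wu i)).
Qed.

Lemma sobolev_is_jet p Omega u : sobolev k p Omega u -> is_jet Omega u (jet k Omega u).
Proof. by move=> [_ wu]; apply: is_jet_jet => i; have [g _ ?] := wu i; exists g. Qed.

Lemma is_jet_local Omega W u v X Y : open Omega -> open W -> W `<=` Omega ->
  is_jet Omega u X -> is_jet Omega v Y ->
  {ae mu, forall x, W x -> u x = v x} -> {ae mu, forall x, W x -> X x = Y x}.
Proof.
move=> oO oW WO uX vY uv.
have : {ae mu, forall x, forall i : J, W x ->
    X x ord0 (enum_rank i) = Y x ord0 (enum_rank i)}.
  apply: ae_forall_countable => i.
  apply: (weak_deriv_local oO oW WO (uX i) (vY i)).
  by apply: filterS uv => x /[apply]; rewrite /comp_of => ->.
apply: filterS => x XY Wx; apply/rowP => i.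
by rewrite -[i]enum_valK; exact: XY.
Qed.

Lemma is_jet_unique Omega u X Y : open Omega ->
  is_jet Omega u X -> is_jet Omega u Y -> {ae mu, forall x, Omega x -> X x = Y x}.
Proof.
by move=> oO uX uY; apply: (is_jet_local oO oO _ uX uY) => //; exact: aeW.
Qed.

Lemma is_jetD Omega u v X Y (c : R) : open Omega ->
  is_jet Omega u X -> is_jet Omega v Y ->
  is_jet Omega (fun x => u x + c *: v x) (fun x => X x + c *: Y x).
Proof.
move=> oO uX vY i; have := is_weak_derivD c oO (uX i) (vY i).
congr (is_weak_deriv _ _ _ _); apply/funext => x; by rewrite /comp_of !mxE.
Qed.

Lemma is_jet_measurable Omega u X (i : 'I_#|{: J}|) : is_jet Omega u X ->
  measurable_fun Omega (fun x => X x ord0 i).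
Proof. by move=> /(_ (enum_val i)) [_ [+ _] _]; rewrite enum_valK. Qed.

Definition index0 (a : 'I_N) : J :=
  Tagged (fun j : 'I_k.+1 => ('I_N * j.-tuple 'I_n)%type) (i := ord0) (a, [tuple]).

Lemma is_jet_comp_measurable Omega u X (a : 'I_N) : is_jet Omega u X ->
  measurable_fun Omega (comp_of u a).
Proof. by move=> /(_ (index0 a)) [[+ _] _ _]. Qed.

Lemma comp_jet_ae Omega u X (a : 'I_N) : open Omega -> is_jet Omega u X ->
  {ae mu, forall x, Omega x -> comp_of u a x = X x ord0 (enum_rank (index0 a))}.
Proof.
move=> oO uX; have [lu lX uXE] := uX (index0 a).
have uu : is_weak_deriv Omega [::] (comp_of u a) (comp_of u a).
  by split => // phi _; rewrite mul1r.
by apply: (weak_deriv_local oO oO (@subset_refl _ _) uu (uX (index0 a))); exact: aeW.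
Qed.

Lemma bounded_jet_sobolev p Omega u X (M : R) : open Omega -> (mu Omega < +oo)%E ->
  p = 1%E \/ p = +oo%E -> is_jet Omega u X ->
  (forall a, {ae mu, forall x, Omega x -> `|comp_of u a x| <= M}) ->
  {ae mu, forall x, Omega x -> `|X x| <= M} -> sobolev k p Omega u.
Proof.
move=> oO Ooo p1oo uX uM XM; have mO := open_measurable_rV oO.
have memp (f : V -> R) : measurable_fun Omega f ->
    {ae mu, forall x, Omega x -> `|f x| <= M} -> memLp Omega p f.
  move=> mf fM; case: p1oo => ->; last exact: bounded_memLoo fM.
  by apply: integrable_memL1 => //; exact: ae_bounded_integrable fM.
split=> [a|i].
  by apply: memp; [exact: is_jet_comp_measurable uX|exact: uM].
exists (fun x => X x ord0 (enum_rank i)); last exact: uX.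
apply: memp; first exact: is_jet_measurable uX.
by apply: filterS XM => x /[apply]; apply: le_trans; exact: ler_coord_norm.
Qed.

Lemma sobolevoo_bounded Omega u : open Omega -> sobolev k +oo%E Omega u ->
  exists M : R, [/\ 0 <= M, forall a, {ae mu, forall x, Omega x -> `|comp_of u a x| <= M} &
    {ae mu, forall x, Omega x -> `|jet k Omega u x| <= M}].
Proof.
move=> oO su; have mO := open_measurable_rV oO; have [ua uw] := su.
have jw := sobolev_is_jet su.
have /choice[Ma HMa] : forall a : 'I_N, exists M : R,
    {ae mu, forall x, Omega x -> `|comp_of u a x| <= M}.
  by move=> a; have [_] := memLoo_bounded mO (ua a).
have /choice[Mi HMi] : forall i : J, exists M : R,
    {ae mu, forall x, Omega x -> `|jet k Omega u x ord0 (enum_rank i)| <= M}.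
  move=> i; have [g gp gw] := uw i.
  have [_ [M gM]] := memLoo_bounded mO gp; exists M.
  have := weak_deriv_local oO oO (@subset_refl _ _) (jw i) gw (aeW _ (fun x _ => erefl)).
  by apply: filterS2 gM => x gx + Ox => /(_ Ox) ->; exact: gx.
pose M := (\sum_a `|Ma a|) + \sum_i `|Mi i|.
have M0 : 0 <= M by rewrite addr_ge0// sumr_ge0.
exists M; split=> // [a|].
  apply: filterS (HMa a) => x /[apply] /le_trans; apply.
  apply: (le_trans (ler_norm _)); rewrite /M (bigD1 a)//= -addrA lerDl.
  by rewrite addr_ge0// sumr_ge0.
have : {ae mu, forall x, forall i : J, Omega x ->
    `|jet k Omega u x ord0 (enum_rank i)| <= Mi i}.
  exact: ae_forall_countable.
apply: filterS => x H Ox; apply: rV_norm_le => // i.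
rewrite -[i]enum_valK; apply: (le_trans (H _ Ox)); apply: (le_trans (ler_norm _)).
rewrite /M (bigD1 (enum_val i))//= addrCA lerDl.
by rewrite addr_ge0// sumr_ge0.
Qed.

(** Perturbing the single component [a0] is enough to raise the energy. *)
Variable a0 : 'I_N.

Definition embed (f : V -> R) : V -> 'rV[R]_N :=
  fun x => \row_a (if a == a0 then f x else 0).

(** The lists of directions are reversed as in [smooth_weak_deriv]. *)
Definition smooth_jet (f : V -> R) : V -> jet_space R n N k :=
  fun x => \row_i let a : J := enum_val i in
    if (tagged a).1 == a0 then pderiv (rev (tagged a).2) f x else 0.

Lemma is_jet_smooth Omega f : open Omega -> smooth f ->
  is_jet Omega (embed f) (smooth_jet f).
Proof.
move=> oO sf i; rewrite /comp_of /embed /smooth_jet.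
under [X in is_weak_deriv _ _ X _]eq_fun do rewrite mxE.
under [X in is_weak_deriv _ _ _ X]eq_fun do rewrite mxE enum_rankK/=.
case: eqP => _; first exact: smooth_weak_deriv.
have := smooth_weak_deriv (tagged i).2 oO (@smooth_cst R n 0).
congr (is_weak_deriv _ _ _ _); apply/funext => x.
by apply: (@pderiv_supported _ _ set0) => //; exact: closed0.
Qed.

Lemma smooth_jetD f g (c : R) x : smooth f -> smooth g ->
  smooth_jet (fun x => f x + c * g x) x = smooth_jet f x + c *: smooth_jet g x.
Proof.
move=> sf sg; apply/rowP => i; rewrite !mxE /=; case: ifP => _; last by rewrite mulr0 addr0.
have sZ : smooth (fun x => c * g x) by apply: smoothM => //; exact: smooth_cst.
by rewrite (pderivD _ sf sZ) (pderivZ _ c sg).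
Qed.

Lemma smooth_jet_supported (K : set V) f x : closed K -> (forall x, ~ K x -> f x = 0) ->
  ~ K x -> smooth_jet f x = 0.
Proof.
move=> cK f0 Kx; apply/rowP => i; rewrite !mxE /=; case: ifP => // _.
exact: pderiv_supported cK f0 _ Kx.
Qed.

End jets.

(** * Raising the energy in a small cube *)

Section bump_family.
Variables (R : realType) (n N k : nat).
Hypothesis (n_gt0 : (0 < n)%N).
Local Notation V := 'rV[R]_n.
Local Notation J := (jet_index n N k).
Local Notation mu := (lebesgue_rV R n).
Variable a0 : 'I_N.

Let i0 : 'I_n := Ordinal n_gt0.

(** The entry for the [k]-th derivative along the first coordinate axis. *)
Definition top_index : J :=
  Tagged (fun j : 'I_k.+1 => ('I_N * j.-tuple 'I_n)%type) (i := ord_max)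
    (a0, nseq_tuple k i0).

Lemma open_small_cube (D : set V) (eta r1 : R) : open D -> D !=set0 -> 0 < eta -> 0 < r1 ->
  exists q, exists2 r : R, 0 < r <= r1 & cube q r `<=` D /\ (mu (cube q r) <= eta%:E)%E.
Proof.
move=> oD [q Dq] eta0 r10.
have /nbhs_ballP [d /= d0 dD] : nbhs q D by exact: open_nbhs_nbhs.
pose r := Num.min (Num.min r1 (d / 2)) (Num.min 2^-1 (eta / 2)).
have r0 : 0 < r by rewrite !lt_min r10 /= !divr_gt0// invr_gt0 ltr0n.
exists q, r; first by rewrite r0 !ge_min lexx.
split.
  move=> x; rewrite /cube/= => xq; apply: dD; rewrite -ball_normE/= distrC.
  apply: (le_lt_trans xq); apply: (@le_lt_trans _ _ (d / 2)).
    by rewrite !ge_min lexx orbT.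
  by rewrite ltr_pdivrMr// ltr_pMr// ltr1n.
rewrite (lebesgue_cube _ (ltW r0)) lee_fin.
have r2 : r *+ 2 <= 1.
  by rewrite -mulr_natr -ler_pdivlMr// mul1r !ge_min lexx orbT.
apply: (@le_trans _ _ (r *+ 2)).
  have r20 : 0 <= r *+ 2 by rewrite mulrn_wge0// ltW.
  by rewrite -[n]prednK// exprS ler_piMr// exprn_ile1.
by rewrite -mulr_natr -ler_pdivlMr// !ge_min lexx !orbT.
Qed.

(** Bumps of amplitude [r ^ k] in cubes of radius [r]: their top-order
    derivatives are independent of [r], while the lower-order ones are of order
    [r]. *)
Lemma bump_family : exists G d : R, [/\ 0 < G, 0 < d &
  forall (q : V) (r : R), 0 < r <= 1 -> exists b : V -> R,
  [/\ smooth b, forall x, ~ cube q r x -> b x = 0,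
      forall x, `|smooth_jet k a0 b x| <= G,
      forall x (i : J), (tag i < k)%N -> `|smooth_jet k a0 b x ord0 (enum_rank i)| <= r * G &
      exists O, [/\ open O, O !=set0, O `<=` cube q r &
        forall x, O x -> d < `|smooth_jet k a0 b x ord0 (enum_rank top_index)|]]].
Proof.
pose B : V -> R := @unit_bump R n.
have sB : smooth B by exact: smooth_box_bump.
have cB := @compact_cube R n 0 1.
have B0 x : ~ cube 0 1 x -> B x = 0 by exact: unit_bump_cube.
have clB : closed (cube (0 : V) (1 : R)) by exact: compact_closed.
have [z Bz] := pderiv_nseq_neq0 i0 k sB cB B0 (ex_intro _ 0 (lt0r_neq0 (@unit_bump0 R n))).
have /choice [Gi HGi] : forall i : J, exists M : R, forall x,
    `|pderiv (rev (tagged i).2) B x| <= M.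
  move=> i; have := @compact_support_bounded _ _ _ (pderiv (rev (tagged i).2) B)
    (smooth_continuous (smooth_pderiv _ sB)) cB (pderiv_supported _ clB B0).
  by move=> [M _ HM]; exists M.
pose G := 1 + \sum_i `|Gi i|.
have G0 : 0 < G by rewrite ltr_pwDl// sumr_ge0.
have GiG i : `|Gi i| <= G.
  by rewrite /G (bigD1 i)//= addrCA lerDl addr_ge0// sumr_ge0.
exists G, (`|pderiv (nseq k i0) B z| / 2); split=> //.
  by rewrite divr_gt0// normr_gt0.
move=> q r /andP[r0 r1].
have rV0 : 0 < r^-1 by rewrite invr_gt0.
have rn0 := ltW r0; have Gn0 := ltW G0.
pose Br x := B (r^-1 *: (x - q)).
have sBr : smooth Br by exact: smooth_affine.
pose b x := r ^+ k * Br x.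
have sb : smooth b by apply: smoothM => //; exact: smooth_cst.
have jb x (i : J) : smooth_jet k a0 b x ord0 (enum_rank i) =
    if (tagged i).1 == a0 then
      r ^+ (k - tag i) * pderiv (rev (tagged i).2) B (r^-1 *: (x - q)) else 0.
  rewrite mxE enum_rankK /=; case: ifP => // _.
  rewrite /b (pderivZ _ _ sBr) /Br (pderiv_affine _ _ _ sB) size_rev size_tuple.
  rewrite mulrA.
  congr (_ * _); have ik : (tag i <= k)%N by rewrite -ltnS.
  by rewrite exprVn -{1}(subnK ik) exprD mulfK// expf_neq0// gt_eqF.
have jG x (i : J) : `|smooth_jet k a0 b x ord0 (enum_rank i)| <= r ^+ (k - tag i) * G.
  rewrite jb; case: ifP => _; last by rewrite normr0 mulr_ge0 ?exprn_ge0.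
  rewrite normrM ger0_norm ?exprn_ge0// ler_wpM2l ?exprn_ge0//.
  by apply: le_trans (HGi _ _) _; exact: le_trans (ler_norm _) (GiG i).
exists b; split=> //.
- move=> x qx; rewrite /b /Br B0 ?mulr0//; apply: contra_not qx.
  by move/cube_rescale; exact.
- move=> x; apply: rV_norm_le => [|i]; first by [].
  rewrite -[i]enum_valK; apply: (le_trans (jG _ _)).
  by rewrite ler_piMl ?exprn_ile1.
- move=> x i ik; apply: (le_trans (jG _ _)); rewrite ler_wpM2r//.
  have : (0 < k - tag i)%N by rewrite subn_gt0.
  case: (k - tag i)%N => // j _.
  by rewrite exprS ler_piMr ?exprn_ile1.
pose T (x : V) := pderiv (nseq k i0) B (r^-1 *: (x - q)).
have cT : continuous T.
  by apply: smooth_continuous; apply: smooth_affine; exact: smooth_pderiv.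
exists ((fun x => `|T x|) @^-1`
  `]`|pderiv (nseq k i0) B z| / 2, +oo[%classic); split.
- apply: open_comp; last exact: interval_open.
  by move=> x _; exact: (cvg_norm (cT x)).
- exists (r *: z + q); rewrite /= in_itv/= andbT /T addrK scalerA mulVf ?gt_eqF//.
  by rewrite scale1r ltr_pdivrMr// ltr_pMr ?normr_gt0// ltr1n.
- move=> x /=; rewrite in_itv/= andbT => Bx.
  apply/(cube_rescale q x r0); apply: contrapT => qx.
  have Bx0 : T x = 0 := pderiv_supported _ clB B0 qx.
  by move: Bx; rewrite Bx0 normr0 ltNge divr_ge0.
- move=> x /=; rewrite in_itv/= andbT jb /= eqxx subnn expr0 mul1r.
  by rewrite rev_nseq.
Qed.

End bump_family.

Section raising.
Variables (R : realType) (n N k : nat).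
Hypothesis (n_gt0 : (0 < n)%N).
Local Notation V := 'rV[R]_n.
Local Notation I := (jet_index n N k).
Local Notation J := (jet_space R n N k).
Local Notation mu := (lebesgue_rV R n).
Variables (a0 : 'I_N) (Omega : set V) (H : V -> J -> R).
Hypothesis Omega_open : open Omega.
Hypothesis H_unif : forall rho eps : R, 0 < rho -> 0 < eps -> exists2 d : R, 0 < d &
  forall x, Omega x -> forall X X', `|X| <= rho -> `|X'| <= rho -> `|X - X'| <= d ->
    `|H x X - H x X'| <= eps.
Hypothesis H_coerc : forall M C : R, exists2 S : R, 0 < S &
  forall x, Omega x -> forall X : J,
    (forall i : I, (tag i < k)%N -> `|X ord0 (enum_rank i)| <= M) ->
    H x X <= C -> `|X| <= S.
Variables (X0 : V -> J) (M C : R).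

Definition perturbed_jet (Phi : V -> R) x : J := X0 x + smooth_jet k a0 Phi x.

(** [eta] is the budget left for later perturbations: for the energy, for the
    lower-order derivatives, and for the measure of their supports. *)
Definition admissible (Phi : V -> R) (eta : R) := [/\ test_function Omega Phi, 0 < eta,
  {ae mu, forall x, Omega x -> H x (perturbed_jet Phi x) <= C - eta} &
  {ae mu, forall x, Omega x -> forall i : I, (tag i < k)%N ->
    `|perturbed_jet Phi x ord0 (enum_rank i)| <= M + 1 - eta *+ 2}].

(** The amplitude of a bump in [D] is increased by steps that change the energy
    density by at most [eta / 2], up to the first value for which the density is
    no longer bounded by [C - eta]; coercivity provides such a value. The new
    budget [eta'] is so small that sets of measure [2 * eta'] cannot cover the
    points where the bound [C - eta] is violated. *)
Lemma raise_energy (D : set V) Phi eta : open D -> D !=set0 -> D `<=` Omega ->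
  admissible Phi eta -> exists Phi' eta' Q,
  [/\ admissible Phi' eta', eta' <= eta / 2, compact Q /\ Q `<=` D,
      (mu Q <= eta%:E)%E /\ (forall x, ~ Q x -> Phi' x = Phi x) &
      forall Z, measurable Z -> (mu Z <= (eta' *+ 2)%:E)%E ->
        ~ {ae mu, forall x, Q x -> ~ Z x -> H x (perturbed_jet Phi' x) <= C - eta}].
Proof.
move=> oD D0 DO [tPhi eta0 HPhi lPhi].
have sPhi := test_function_smooth tPhi.
have [S S0 HS] := H_coerc (M + 2) C.
have eta2 : 0 < eta / 2 by rewrite divr_gt0.
have S10 : 0 < S + 1 by rewrite addr_gt0.
have [d1 d10 Hd1] := H_unif S10 eta2.
pose d := Num.min d1 1.
have d0 : 0 < d by rewrite lt_min d10 ltr01.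
have [G [del [G0 del0 bumps]]] := bump_family R k n_gt0 a0.
pose tau := d / G.
have tau0 : 0 < tau by rewrite divr_gt0.
(* After [m0] steps the top-order derivative of the bump exceeds twice the bound
   [S] on jets of energy at most [C]. *)
pose m0 := Num.bound (S *+ 2 / (tau * del)).
have m0S : S *+ 2 < m0%:R * (tau * del).
  have B0 : 0 <= S *+ 2 / (tau * del).
    by rewrite divr_ge0 ?mulrn_wge0 ?(ltW S0)// ltW// mulr_gt0.
  by have := archi_boundP B0; rewrite -/m0 ltr_pdivrMr// mulr_gt0.
have A0 : 0 < m0%:R * tau * G + 1 by rewrite ltr_wpDl// mulr_ge0 ?(ltW G0)// mulr_ge0 ?(ltW tau0).
(* The cube is chosen after [m0], so that the lower-order derivatives remain small
   up to that amplitude. *)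
pose r1 := Num.min 1 (eta / (m0%:R * tau * G + 1)).
have r10 : 0 < r1 by rewrite lt_min ltr01 divr_gt0.
have [q [r /andP[r0 rr1] [QD muQ]]] := open_small_cube n_gt0 oD D0 eta0 r10.
set Q := cube q r in QD muQ.
have cQ : compact Q by exact: compact_cube.
have clQ : closed Q by exact: compact_closed.
have r01 : 0 < r <= 1 by rewrite r0 (le_trans rr1)// ge_min lexx.
have rA : m0%:R * tau * (r * G) <= eta.
  have : r * (m0%:R * tau * G + 1) <= eta.
    by rewrite -ler_pdivlMr// (le_trans rr1)// ge_min lexx orbT.
  have -> : m0%:R * tau * (r * G) = r * (m0%:R * tau * G + 1) - r by ring.
  by apply: le_trans; rewrite lerBlDr lerDl ltW.
have [b [sb b0 bG b_low [W [oW W0 WQ Wb]]]] := bumps q r r01.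
pose Phij (j : nat) x := Phi x + (j%:R * tau) * b x.
have jetj j x : perturbed_jet (Phij j) x =
    perturbed_jet Phi x + (j%:R * tau) *: smooth_jet k a0 b x.
  by rewrite /perturbed_jet smooth_jetD// addrA.
have lj j : (j <= m0)%N -> {ae mu, forall x, Omega x -> forall i : I, (tag i < k)%N ->
    `|perturbed_jet (Phij j) x ord0 (enum_rank i)| <= M + 1 - eta}.
  move=> jm; apply: filterS lPhi => x lx Ox i ik.
  rewrite jetj mxE [X in _ + X]mxE.
  apply: (le_trans (ler_normD _ _)).
  have H1 := lx Ox i ik.
  have H2 : `|j%:R * tau * smooth_jet k a0 b x ord0 (enum_rank i)| <= eta.
    have jt0 : 0 <= j%:R * tau by rewrite mulr_ge0// ltW.
    rewrite normrM (ger0_norm jt0).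
    apply: le_trans rA; apply: ler_pM => //; last exact: b_low.
    by rewrite ler_wpM2r ?(ltW tau0)// ler_nat.
  by have := lerD H1 H2; rewrite mulr2n => /le_trans; apply; lra.
have ltM : M + 1 - eta <= M + 2 by lra.
pose P j := {ae mu, forall x, Omega x -> H x (perturbed_jet (Phij j) x) <= C - eta}.
have PS j : (j <= m0)%N -> P j ->
    {ae mu, forall x, Omega x -> `|perturbed_jet (Phij j) x| <= S}.
  move=> jm Pj; apply: filterS2 Pj (lj j jm) => x HC lx Ox.
  apply: (HS x Ox) => [i ik|]; first exact: le_trans (lx Ox i ik) ltM.
  by apply: (le_trans (HC Ox)); rewrite gerBl ltW.
have P0 : P 0%N.
  apply: filterS HPhi => x /[apply]; rewrite /Phij.
  by rewrite (_ : (fun x => _) = Phi)//; apply/funext => y; rewrite !mul0r addr0.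
have nPm0 : ~ P m0.
  move=> Pm; apply: (open_not_negligible oW W0).
  have : {ae mu, forall x, Omega x -> `|perturbed_jet (Phij 0) x| <= S /\
      `|perturbed_jet (Phij m0) x| <= S}.
    apply: filterS2 (PS _ (leq0n _) P0) (PS _ (leqnn _) Pm) => x h1 h2 Ox.
    by split; [exact: h1|exact: h2].
  apply: negligibleS => x Ox /(_ (DO _ (QD _ (WQ _ Ox)))) [H1 H2].
  have := Wb x Ox; apply/negP; rewrite -leNgt.
  have m0gt : 0 < m0%:R * tau.
    move: m0S; rewrite mulrA => m0S; have := lt_trans _ m0S => /(_ 0).
    by rewrite mulrn_wgt0// => /(_ isT); rewrite pmulr_lgt0.
  rewrite -(ler_pM2l m0gt).
  set t := top_index k n_gt0 a0.
  rewrite -(ger0_norm (ltW m0gt)) -normrM.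
  have -> : m0%:R * tau * smooth_jet k a0 b x ord0 (enum_rank t) =
      (perturbed_jet (Phij m0) x - perturbed_jet (Phij 0) x) ord0 (enum_rank t).
    rewrite !jetj opprD addrACA subrr add0r -scalerBl mul0r subr0.
    by rewrite [RHS]mxE.
  apply: (le_trans (ler_coord_norm _ _)); apply: (le_trans (ler_normB _ _)).
  apply: (le_trans (lerD H2 H1)).
  by rewrite ger0_norm ?(ltW m0gt)// -mulrA -mulr2n ltW.
have exP : exists j, `[< ~ P j >] by exists m0; apply/asboolP.
case: (ex_minnP exP) => j /asboolP nPj jmin.
have jm : (j <= m0)%N by apply: jmin; apply/asboolP.
case: j => [//|j] in nPj jmin jm *.
have Pj : P j.
  by apply: contrapT => nPj'; have := jmin j (asboolT nPj'); rewrite ltnn.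
have stepj : {ae mu, forall x, Omega x ->
    H x (perturbed_jet (Phij j.+1) x) <= C - eta / 2}.
  apply: filterS2 Pj (PS _ (ltnW jm) Pj) => x HC XS Ox.
  have D1 : `|perturbed_jet (Phij j.+1) x - perturbed_jet (Phij j) x| <= d.
    rewrite !jetj opprD addrACA subrr add0r -scalerBl normrZ.
    rewrite -mulrBl -natrB// subSnn mul1r gtr0_norm//.
    by rewrite /tau mulrAC ler_pdivrMr// ler_wpM2l// ltW.
  have XS1 : `|perturbed_jet (Phij j.+1) x| <= S + 1.
    rewrite -[perturbed_jet (Phij j.+1) x](subrK (perturbed_jet (Phij j) x)) addrC.
    apply: (le_trans (ler_normD _ _)); apply: lerD; first exact: XS.
    by apply: (le_trans D1); rewrite ge_min lexx orbT.
  have := Hd1 x Ox (perturbed_jet (Phij j.+1) x) (perturbed_jet (Phij j) x) XS1.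
  rewrite (le_trans (XS Ox)) ?lerDl// (le_trans D1) ?ge_min ?lexx// => /(_ isT isT).
  by rewrite ler_norml => /andP[_]; have := HC Ox; lra.
pose A := [set x | Q x /\ ~ (H x (perturbed_jet (Phij j.+1) x) <= C - eta)].
have nA : ~ mu.-negligible A.
  move=> nA; apply: nPj.
  have HA : {ae mu, forall x, ~ A x} by move: nA; apply: negligibleS => x /contrapT.
  apply: filterS2 HA HPhi => x nAx HPx Ox.
  have [Qx|Qx] := pselect (Q x).
    by apply: contrapT => Hx; apply: nAx.
  by rewrite jetj (smooth_jet_supported _ _ clQ b0 Qx) scaler0 addr0; exact: HPx.
have [e e0 He] := not_negligible_outer nA.
exists (Phij j.+1), (Num.min (eta / 2) (e / 2)), Q; split.
- have m1 : Num.min (eta / 2) (e / 2) <= eta / 2 by rewrite ge_min lexx.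
  split.
  + have tb : test_function Omega b.
      apply: (supported_test_function sb cQ) => //.
      exact: subset_trans QD DO.
    exact: test_functionD tPhi (test_functionM (@smooth_cst _ _ _) tb).
  + by rewrite lt_min eta2 divr_gt0.
  + by apply: filterS stepj => x /[apply]; move: m1; lra.
  + apply: filterS (lj _ jm) => x + Ox i ik => /(_ Ox i ik) /le_trans; apply.
    by move: m1; rewrite (mulr2n (Num.min _ _)); lra.
- by rewrite ge_min lexx.
- by [].
- split=> // x Qx; by rewrite /Phij (b0 x Qx) mulr0 addr0.
- move=> Z mZ muZ; have Ze : (mu Z <= e%:E)%E.
    apply: (le_trans muZ); rewrite lee_fin (mulr2n (Num.min _ _)).
    have : Num.min (eta / 2) (e / 2) <= e / 2 by rewrite ge_min lexx orbT.
    lra.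
  move=> HZ; apply: (He Z mZ Ze); move: HZ; apply: negligibleS => x [[Qx Hx] Zx] /=.
  by move=> /(_ Qx Zx).
Qed.

End raising.

(** * Infinitely many successive perturbations *)

Section iteration.
Variables (R : realType) (n N k : nat).
Hypothesis (n_gt0 : (0 < n)%N).
Local Notation V := 'rV[R]_n.
Local Notation I := (jet_index n N k).
Local Notation J := (jet_space R n N k).
Local Notation mu := (lebesgue_rV R n).
Variables (a0 : 'I_N) (Omega : set V) (H : V -> J -> R).
Hypothesis Omega_open : open Omega.
Hypothesis H_unif : forall rho eps : R, 0 < rho -> 0 < eps -> exists2 d : R, 0 < d &
  forall x, Omega x -> forall X X', `|X| <= rho -> `|X'| <= rho -> `|X - X'| <= d ->
    `|H x X - H x X'| <= eps.
Hypothesis H_coerc : forall M C : R, exists2 S : R, 0 < S &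
  forall x, Omega x -> forall X : J,
    (forall i : I, (tag i < k)%N -> `|X ord0 (enum_rank i)| <= M) ->
    H x X <= C -> `|X| <= S.
Variables (X0 : V -> J) (M C : R).

Local Notation pjet := (perturbed_jet a0 X0).
Local Notation adm := (admissible a0 Omega H X0 M C).

(** Whenever the prescribed set [D m] is not inside [Omega], step [m] only halves
    the budget. *)
Lemma iterate_raise (D : nat -> set V) Phi0 eta0 : (forall m, open (D m)) ->
  (forall m, D m !=set0) -> adm Phi0 eta0 ->
  exists (Phi : nat -> V -> R) (eta : nat -> R) (Q : nat -> set V), forall m,
  [/\ adm (Phi m) (eta m), eta m.+1 <= eta m / 2, compact (Q m),
      (mu (Q m) <= (eta m)%:E)%E /\ (forall x, ~ Q m x -> Phi m.+1 x = Phi m x) &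
      D m `<=` Omega -> Q m `<=` D m /\
      forall Z, measurable Z -> (mu Z <= (eta m.+1 *+ 2)%:E)%E ->
        ~ {ae mu, forall x, Q m x -> ~ Z x -> H x (pjet (Phi m.+1) x) <= C - eta m}].
Proof.
move=> oD D0 adm0.
pose T := {p : (V -> R) * R | adm p.1 p.2}.
have /choice [next Hnext] : forall z : nat * T, exists w : T * set V,
    [/\ (sval w.1).2 <= (sval z.2).2 / 2, compact w.2,
      (mu w.2 <= ((sval z.2).2)%:E)%E /\
        (forall x, ~ w.2 x -> (sval w.1).1 x = (sval z.2).1 x) &
      D z.1 `<=` Omega -> w.2 `<=` D z.1 /\
      forall Z, measurable Z -> (mu Z <= ((sval w.1).2 *+ 2)%:E)%E ->
        ~ {ae mu, forall x, w.2 x -> ~ Z x ->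
             H x (pjet (sval w.1).1 x) <= C - (sval z.2).2}].
  move=> [m [[Phi eta] /= aPhi]].
  have [DO|nDO] := pselect (D m `<=` Omega).
    have [Phi' [eta' [Q [a' e' [cQ QD] [muQ eqQ] HQ]]]] :=
      raise_energy n_gt0 H_unif H_coerc (oD m) (D0 m) DO aPhi.
    by exists (exist _ (Phi', eta') a', Q).
  have eta0_gt : 0 < eta by case: aPhi.
  have a' : adm Phi (eta / 2).
    case: aPhi => tP e0 HP lP; split => //; first by rewrite divr_gt0.
      by apply: filterS HP => x /[apply]; lra.
    apply: filterS lP => x + Ox i ik => /(_ Ox i ik) /le_trans; apply.
    by rewrite (mulr2n eta) (mulr2n (eta / 2)); lra.
  exists (exist _ (Phi, eta / 2) a', set0); split => //=.
    exact: compact0.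
  by split => //; rewrite measure0 lee_fin ltW.
pose st := fix st m : T := if m is m'.+1 then (next (m', st m')).1
  else exist (fun p => adm p.1 p.2) (Phi0, eta0) adm0.
exists (fun m => (sval (st m)).1), (fun m => (sval (st m)).2),
  (fun m => (next (m, st m)).2) => m.
have [h1 h2 h3 h4] := Hnext (m, st m).
by split => //; exact: (svalP (st m)).
Qed.

Section limit.
Variables (Phi : nat -> V -> R) (eta : nat -> R) (Q : nat -> set V).
Hypothesis adm_Phi : forall m, adm (Phi m) (eta m).
Hypothesis eta_half : forall m, eta m.+1 <= eta m / 2.
Hypothesis Q_compact : forall m, compact (Q m).
Hypothesis Q_small : forall m, (mu (Q m) <= (eta m)%:E)%E.
Hypothesis Q_eq : forall m x, ~ Q m x -> Phi m.+1 x = Phi m x.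

Lemma eta_gt0 m : 0 < eta m.
Proof. by case: (adm_Phi m). Qed.

Lemma eta_geometric m i : eta (m + i)%N <= eta m / 2 ^+ i.
Proof.
elim: i => [|i IH]; first by rewrite addn0 expr0 divr1.
rewrite addnS (le_trans (eta_half _))// exprS invfM [2^-1 * _]mulrC mulrA.
by rewrite ler_pM2r// invr_gt0.
Qed.

Lemma eta_lt (e : R) : 0 < e -> exists m0, forall m, (m0 <= m)%N -> eta m < e.
Proof.
move=> e0; have ee : 0 < e / (eta 0 + 1) by rewrite divr_gt0// addr_gt0// eta_gt0.
have [m0 _ H0] := near_infty_natSinv_lt (PosNum ee).
exists m0 => m /H0 /= me; rewrite -[m]add0n.
apply: (le_lt_trans (eta_geometric _ _)).
have em : 0 < eta 0 + 1 by rewrite addr_gt0// eta_gt0.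
move: me; rewrite ltr_pdivlMr// => /(le_lt_trans _); apply.
rewrite mulrC; apply: ler_pM; rewrite ?invr_ge0 ?exprn_ge0 ?(ltW (eta_gt0 _)) ?lerDl//.
by rewrite lef_pV2 ?posrE ?exprn_gt0// -natrX ler_nat ltn_expl.
Qed.

Definition touched_from m : set V := \bigcup_i Q (m + i)%N.

Lemma measurable_touched_from m : measurable (touched_from m).
Proof. by apply: bigcupT_measurable => i; exact: measurable_compact. Qed.

Lemma mu_touched_from m : (mu (touched_from m) <= (eta m *+ 2)%:E)%E.
Proof.
apply: (@le_trans _ _ (\sum_(i <oo) mu (Q (m + i)%N))%E).
  apply: measure_sigma_subadditive => //.
    by move=> i; exact: measurable_compact.
  exact: measurable_touched_from.
have e2 : 0 <= eta m *+ 2 by rewrite mulrn_wge0// ltW// eta_gt0.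
apply: le_trans (epsilon_trick0 xpredT e2).
apply: lee_nneseries => // i _; apply: (le_trans (Q_small _)); rewrite lee_fin.
apply: (le_trans (eta_geometric _ _)).
by rewrite natrX exprS invfM mulrA -(mulr_natr (eta m)) mulfK.
Qed.

Lemma touched_fromS m : touched_from m.+1 `<=` touched_from m.
Proof. by move=> x [i _ Qx]; exists i.+1 => //; rewrite addnS. Qed.

Lemma jet_off_Q m x : ~ Q m x -> smooth_jet k a0 (Phi m.+1) x = smooth_jet k a0 (Phi m) x.
Proof.
move=> Qx; apply/rowP => i; rewrite !mxE /=; case: ifP => // _.
apply: (@pderiv_local _ _ _ (Phi m.+1) (Phi m) (~` Q m)).
- by apply: closed_openC; exact: compact_closed.
- by move=> y; rewrite inE; exact: Q_eq.
- by rewrite inE.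
Qed.

Lemma Phi_off_touched_from m x : ~ touched_from m x -> forall i, Phi (m + i)%N x = Phi m x /\
  smooth_jet k a0 (Phi (m + i)%N) x = smooth_jet k a0 (Phi m) x.
Proof.
move=> Tx; elim=> [|i [IH1 IH2]]; first by rewrite addn0.
have Qx : ~ Q (m + i)%N x by move=> Qx; apply: Tx; exists i.
by rewrite addnS Q_eq// jet_off_Q.
Qed.

Definition touched_often : set V := \bigcap_m touched_from m.

Lemma measurable_touched_often : measurable touched_often.
Proof. by apply: bigcapT_measurable => m; exact: measurable_touched_from. Qed.

Lemma touched_often_null : {ae mu, forall x, ~ touched_often x}.
Proof.
suff : mu.-negligible touched_often.
  by apply: negligibleS => x /contrapT.
apply/negligibleP; first exact: measurable_touched_often.
apply/eqP; rewrite eq_le measure_ge0 andbT.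
apply/lee_addgt0Pr => e e0; rewrite add0e.
have e2 : 0 < e / 2 by rewrite divr_gt0.
have [m0 /(_ _ (leqnn _)) em] := eta_lt e2.
apply: (@le_trans _ _ (mu (touched_from m0))).
  apply: le_measure; rewrite ?inE;
    [exact: measurable_touched_often|exact: measurable_touched_from|].
  exact: bigcap_inf.
by apply: (le_trans (mu_touched_from _)); rewrite lee_fin (mulr2n (eta _)); lra.
Qed.

Lemma stop_step : exists st : V -> nat, forall x, ~ touched_often x -> ~ touched_from (st x) x.
Proof.
have /choice [st Hst] : forall x, exists m, ~ touched_often x -> ~ touched_from m x;
  last by exists st.
move=> x; have [ox|/existsNP [m /not_implyP[_ tx]]] := pselect (touched_often x).
  by exists 0%N.
by exists m.
Qed.

Variables (u0 : V -> 'rV[R]_N) (st : V -> nat).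
Hypothesis u0_jet : is_jet Omega u0 X0.
Hypothesis stE : forall x, ~ touched_often x -> ~ touched_from (st x) x.

Definition Phi_lim x := if pselect (touched_often x) then 0 else Phi (st x) x.

Definition jet_lim x : J :=
  X0 x + (if pselect (touched_often x) then 0 else smooth_jet k a0 (Phi (st x)) x).

Definition u_seq m x := u0 x + 1 *: embed a0 (Phi m) x.

Definition u_lim x := u0 x + embed a0 Phi_lim x.

Lemma u_seq_jet m : is_jet Omega (u_seq m) (pjet (Phi m)).
Proof.
have [tP _ _ _] := adm_Phi m.
have := is_jetD 1 Omega_open u0_jet
  (@is_jet_smooth R n N k a0 _ _ Omega_open (test_function_smooth tP)).
congr (is_jet _ _ _); apply/funext => x.
by rewrite /perturbed_jet scale1r.
Qed.

(** A point off a null set lies in finitely many of the [Q m], so that values and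
    jets there are those of any late enough stage. *)
Lemma stationary x m : ~ touched_often x -> ~ touched_from m x ->
  Phi_lim x = Phi m x /\ jet_lim x = pjet (Phi m) x.
Proof.
move=> ox tx.
have E : Phi (st x) x = Phi m x /\
    smooth_jet k a0 (Phi (st x)) x = smooth_jet k a0 (Phi m) x.
  have [P1 S1] := Phi_off_touched_from (stE ox) m; have [P2 S2] := Phi_off_touched_from tx (st x).
  by rewrite -P1 -S1 addnC P2 S2.
have PE : Phi_lim x = Phi m x by rewrite /Phi_lim; case: pselect => [?|?] //=; exact: E.1.
by split => //; rewrite /jet_lim; case: pselect => [?|?] //=; rewrite E.2.
Qed.

Lemma u_lim_stationary x m : ~ touched_often x -> ~ touched_from m x -> u_lim x = u_seq m x.
Proof.
move=> ox tx; have [PE _] := stationary ox tx.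
rewrite /u_lim /u_seq scale1r; congr (_ + _).
by apply/rowP => a; rewrite !mxE PE.
Qed.

Lemma stationary_after x m : ~ touched_often x -> (st x <= m)%N -> ~ touched_from m x.
Proof.
move=> ox /subnKC <-; elim: (m - st x)%N => [|i IH]; first by rewrite addn0; exact: stE.
by rewrite addnS => /touched_fromS.
Qed.

Lemma pjet_bounded : exists2 S : R, 0 < S &
  forall m, {ae mu, forall x, Omega x -> `|pjet (Phi m) x| <= S}.
Proof.
have [S S0 HS] := H_coerc (M + 1) C; exists S => // m.
have [_ e0 HP lP] := adm_Phi m.
apply: filterS2 HP lP => x HPx lPx Ox; apply: (HS x Ox) => [i ik|].
  by apply: (le_trans (lPx Ox i ik)); rewrite (mulr2n (eta m)); lra.
by apply: (le_trans (HPx Ox)); lra.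
Qed.

Lemma u_lim_jet : is_jet Omega u_lim jet_lim.
Proof.
have mO := open_measurable_rV Omega_open.
have [S S0 HS] := pjet_bounded.
have good : {ae mu, forall x, ~ touched_often x} := touched_often_null.
move=> i.
have mlim (c f : V -> R) (F : nat -> V -> R) : (forall m, measurable_fun Omega (F m)) ->
    measurable_fun Omega c -> (forall x, touched_often x -> f x = c x) ->
    (forall x m, ~ touched_often x -> ~ touched_from m x -> f x = F m x) -> measurable_fun Omega f.
  move=> mF mc fc fF.
  pose G m x := c x * \1_touched_often x + F m x * \1_(~` touched_often) x.
  apply: (@measurable_fun_cvg _ _ _ Omega G) => [m|x _].
    apply: measurable_funD; apply: measurable_funM => //.
      by apply: measurable_indic; exact: measurable_touched_often.
    by apply: measurable_indic; apply: measurableC; exact: measurable_touched_often.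
  rewrite /G; have [ox|ox] := pselect (touched_often x).
    rewrite fc//; apply: cvg_near_cst; apply: nearW => m.
    by rewrite !indicE mem_set// memNset//= mulr1 mulr0 addr0.
  apply: cvg_near_cst; exists (st x) => // m /= xm.
  rewrite !indicE memNset// mem_set//= mulr1 mulr0 add0r.
  by rewrite (fF x m)//; exact: stationary_after.
apply: (@weak_deriv_lim _ _ Omega _ _ _
  (fun m => comp_of (u_seq m) (tagged i).1)
  (fun m x => pjet (Phi m) x ord0 (enum_rank i)) S) => //.
- by move=> m; exact: u_seq_jet.
- apply: (mlim (comp_of u0 (tagged i).1) _ (fun m => comp_of (u_seq m) (tagged i).1)).
  + by move=> m; exact: is_jet_comp_measurable (u_seq_jet m).
  + exact: is_jet_comp_measurable u0_jet.
  + move=> x ox; rewrite /comp_of /u_lim !mxE /Phi_lim; case: pselect => [?|?] //=.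
    by rewrite if_same addr0.
  + by move=> x m ox tx; rewrite /comp_of (u_lim_stationary ox tx).
- apply: (mlim (fun x => X0 x ord0 (enum_rank i)) _
    (fun m x => pjet (Phi m) x ord0 (enum_rank i))).
  + by move=> m; exact: is_jet_measurable (u_seq_jet m).
  + exact: is_jet_measurable u0_jet.
  + by move=> x ox; rewrite /jet_lim; case: pselect => [?|?] //=; rewrite addr0.
  + by move=> x m ox tx; have [_ ->] := stationary ox tx.
- have H1 := ae_foralln HS.
  have H2 := ae_foralln (fun m => comp_jet_ae (tagged i).1 Omega_open (u_seq_jet m)).
  apply: filterS2 H1 H2 => x H1 H2 Ox m; rewrite (H2 m Ox).
  by split; apply: (le_trans (ler_coord_norm _ _)); exact: H1.
- apply: filterS good => x ox _; split; apply: cvg_near_cst; exists (st x) => // m /= xm;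
    have tx := stationary_after ox xm.
    by rewrite /comp_of (u_lim_stationary ox tx).
  by have [_ ->] := stationary ox tx.
Qed.

Lemma jet_lim_energy : {ae mu, forall x, Omega x -> H x (jet_lim x) <= C}.
Proof.
have H1 : forall m, {ae mu, forall x, Omega x -> H x (pjet (Phi m) x) <= C - eta m}.
  by move=> m; have [_ _ HP _] := adm_Phi m.
apply: filterS2 touched_often_null (ae_foralln H1) => x ox H2 Ox.
have [_ ->] := stationary ox (stE ox).
by apply: (le_trans (H2 _ Ox)); rewrite gerBl ltW// eta_gt0.
Qed.

(** The later perturbations act on a set too small to undo the gain of step [m]. *)
Lemma jet_lim_persistent m :
  (forall Z, measurable Z -> (mu Z <= (eta m.+1 *+ 2)%:E)%E ->
    ~ {ae mu, forall x, Q m x -> ~ Z x -> H x (pjet (Phi m.+1) x) <= C - eta m}) ->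
  ~ {ae mu, forall x, Q m x -> H x (jet_lim x) <= C - eta m}.
Proof.
move=> HZ HQ; apply: (HZ _ (measurable_touched_from m.+1) (mu_touched_from m.+1)).
apply: filterS2 touched_often_null HQ => x ox HQ Qx tx.
by have [_ <-] := stationary ox tx; exact: HQ.
Qed.

Hypothesis Omega_fin : (mu Omega < +oo)%E.
Hypothesis X0_bounded : exists S : R, {ae mu, forall x, Omega x -> `|X0 x| <= S}.

Lemma jet_lim_bounded : exists2 S : R, 0 < S &
  {ae mu, forall x, Omega x -> `|jet_lim x| <= S} /\
  forall m, {ae mu, forall x, Omega x -> `|pjet (Phi m) x| <= S}.
Proof.
have [S S0 HS] := pjet_bounded; exists S => //; split => //.
apply: filterS2 touched_often_null (ae_foralln HS) => x ox HSx Ox.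
by have [_ ->] := stationary ox (stE ox); exact: HSx.
Qed.

Lemma u_lim_sobolev : sobolev k +oo%E Omega u_lim.
Proof.
have [S S0 [HS _]] := jet_lim_bounded.
apply: (bounded_jet_sobolev Omega_open Omega_fin _ u_lim_jet _ HS); first by right.
move=> a; apply: filterS2 HS (comp_jet_ae a Omega_open u_lim_jet) => x HSx + Ox => /(_ Ox) ->.
by apply: le_trans (ler_coord_norm _ _) _; exact: HSx.
Qed.

(** The limit differs from the [m]-th stage on a set whose measure tends to zero,
    and the jets are uniformly bounded. *)
Lemma u_lim_boundary : sobolevoo_bc k Omega u0 u_lim.
Proof.
have mO := open_measurable_rV Omega_open.
have [S S0 [HS HSm]] := jet_lim_bounded.
have [S' HS'] := X0_bounded.
pose w := (u_lim \- u0)%R.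
have wjet : is_jet Omega w (fun x => jet_lim x + -1 *: X0 x).
  have := is_jetD (-1) Omega_open u_lim_jet u0_jet.
  by congr (is_jet _ _ _); apply/funext => x; rewrite scaleN1r.
have wB : {ae mu, forall x, Omega x -> `|jet_lim x + -1 *: X0 x| <= S + S'}.
  apply: filterS2 HS HS' => x h1 h2 Ox; rewrite scaleN1r.
  by apply: (le_trans (ler_normB _ _)); apply: lerD; [exact: h1|exact: h2].
have wS p : p = 1%E \/ p = +oo%E -> sobolev k p Omega w.
  move=> p1; apply: (bounded_jet_sobolev Omega_open Omega_fin p1 wjet _ wB) => a.
  apply: filterS2 wB (comp_jet_ae a Omega_open wjet) => x h + Ox => /(_ Ox) ->.
  by apply: le_trans (ler_coord_norm _ _) _; exact: h.
split; first by apply: wS; right.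
split; first by apply: wS; left.
move=> e e0; pose c : R := #|{: I}|%:R * (S *+ 2) + 1.
have c0 : 0 < c by rewrite ltr_wpDl// mulr_ge0// mulrn_wge0// ltW.
have ec : 0 < e / (c *+ 2) by rewrite divr_gt0// mulrn_wgt0.
have [m /(_ _ (leqnn _)) em] := eta_lt ec.
exists (embed a0 (Phi m)); split.
  move=> a; rewrite /embed; under eq_fun do rewrite mxE.
  case: eqP => _; last exact: test_function0.
  by have [] := adm_Phi m.
have [tP _ _ _] := adm_Phi m.
have dj : is_jet Omega (w \- embed a0 (Phi m))%R (fun x => jet_lim x + -1 *: pjet (Phi m) x).
  have := is_jetD (-1) Omega_open u_lim_jet (u_seq_jet m).
  congr (is_jet _ _ _); apply/funext => x.
  by rewrite /w /u_seq scaleN1r scale1r opprD addrA.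
have djE := is_jet_unique Omega_open (is_jet_jet (fun i => ex_intro _ _ (dj i))) dj.
have S20 : 0 <= S *+ 2 by rewrite mulrn_wge0// ltW.
rewrite /sobolev_norm.
apply: (@le_lt_trans _ _ (\sum_(i < #|{: I}|) ((S *+ 2 * (eta m *+ 2))%:E))%E).
  apply: lee_sum => i _.
  apply: (@le_trans _ _ ((S *+ 2)%:E * mu (touched_from m))%E); last first.
    by rewrite EFinM lee_wpmul2l ?lee_fin//; exact: mu_touched_from.
  apply: Lnorm1_le => //.
  - by apply: is_jet_measurable; apply: is_jet_jet => l; eexists; exact: (dj l).
  - exact: measurable_touched_from.
  - apply: filterS3 djE HS (HSm m) => x E h1 h2 Ox; rewrite (E Ox) scaleN1r.
    apply: (le_trans (ler_coord_norm _ _)); apply: (le_trans (ler_normB _ _)).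
    by rewrite (mulr2n S); apply: lerD; [exact: h1|exact: h2].
  - apply: filterS2 djE touched_often_null => x E ox Ox tx; rewrite (E Ox).
    by have [_ ->] := stationary ox tx; rewrite scaleN1r subrr mxE.
rewrite sumEFin lte_fin sumr_const card_ord -mulr_natl.
move: em; rewrite ltr_pdivlMr ?mulrn_wgt0// => em.
apply: (le_lt_trans _ em).
rewrite mulrA [leLHS]mulrnAr [leRHS]mulrnAr [eta m * c]mulrC lerMn2r /=.
by apply: ler_wpM2r; [exact/ltW/eta_gt0|rewrite lerDl].
Qed.

End limit.
End iteration.

(** * Saturated maps *)

Section saturated.
Variables (R : realType) (n N k : nat).
Hypothesis (n_gt0 : (0 < n)%N).
Local Notation V := 'rV[R]_n.
Local Notation I := (jet_index n N k).
Local Notation J := (jet_space R n N k).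
Local Notation mu := (lebesgue_rV R n).
Variables (Omega : set V) (H : V -> J -> R).
Hypothesis Omega_open : open Omega.

(** This replaces the equation [H x (jet u x) = C] almost everywhere: only the
    essential suprema over open sets matter for absolute minimality. *)
Definition saturated (C : R) (u : V -> 'rV[R]_N) :=
  {ae mu, forall x, Omega x -> H x (jet k Omega u x) <= C} /\
  forall U, open U -> U !=set0 -> U `<=` Omega -> forall y, y < C ->
    ~ {ae mu, forall x, U x -> H x (jet k Omega u x) <= y}.

Lemma injective_unbounded (f : nat -> nat) m : injective f -> exists j, (m <= f j)%N.
Proof.
move=> fi; apply: contrapT => /forallNP fm.
have fm' j : (f j < m)%N by rewrite ltnNge; apply/negP; exact: fm.
have : injective (fun j : 'I_m.+1 => Ordinal (fm' j)) by move=> i j [/fi /val_inj].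
by move=> /leq_card; rewrite !card_ord ltnn.
Qed.

Definition rational_ball (m : nat) : set V :=
  if (unpickle m : option ('rV[rat]_n * nat)) is Some (q, j)
  then ball (map_mx ratr q : V) j.+1%:R^-1
  else setT.

Lemma rational_ball_open m : open (rational_ball m).
Proof.
rewrite /rational_ball; case: unpickle => [[q j]|]; last exact: openT.
exact: ball_open.
Qed.

Lemma rational_ball_neq0 m : rational_ball m !=set0.
Proof.
rewrite /rational_ball; case: unpickle => [[q j]|]; last by exists 0.
by exists (map_mx ratr q); exact: ballxx.
Qed.

(** Arbitrarily large indices are needed because the bounds reached in the
    construction only approach [C] in the limit. *)
Lemma rational_ball_sub U m0 : open U -> U !=set0 ->
  exists2 m, (m0 <= m)%N & rational_ball m `<=` U.
Proof.
move=> oU [x Ux]; have [j0 jU] := open_rat_cube oU Ux.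
have /choice [q Hq] : forall j, exists q : 'rV[rat]_n,
    cube (map_mx ratr q) ((j0 + j).+1%:R^-1 *+ 2) `<=` U.
  by move=> j; have [q [_ qU]] := jU _ (leq_addr j j0); exists q.
have fi : injective (fun j => pickle (q j, (j0 + j)%N)).
  by move=> i j /(pcan_inj pickleK) [_ /addnI].
have [j mj] := injective_unbounded m0 fi.
exists (pickle (q j, (j0 + j)%N)) => //.
rewrite /rational_ball pickleK; apply: subset_trans (Hq j) => y.
rewrite -ball_normE/= distrC /cube/= => /ltW /le_trans; apply.
by rewrite mulr2n lerDl invr_ge0.
Qed.

Hypothesis H_unif : forall rho eps : R, 0 < rho -> 0 < eps -> exists2 d : R, 0 < d &
  forall x, Omega x -> forall X X', `|X| <= rho -> `|X'| <= rho -> `|X - X'| <= d ->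
    `|H x X - H x X'| <= eps.
Hypothesis H_coerc : forall M C : R, exists2 S : R, 0 < S &
  forall x, Omega x -> forall X : J,
    (forall i : I, (tag i < k)%N -> `|X ord0 (enum_rank i)| <= M) ->
    H x X <= C -> `|X| <= S.
Hypothesis H_bdd : forall rho : R, exists C : R,
  forall x, Omega x -> forall X, `|X| <= rho -> H x X <= C.
Hypothesis Omega_fin : (mu Omega < +oo)%E.
Variable a0 : 'I_N.

Lemma exists_saturated (u0 : V -> 'rV[R]_N) : sobolev k +oo%E Omega u0 ->
  exists C0 : R, forall C, C0 < C -> exists u,
    [/\ sobolevoo_bc k Omega u0 u, sobolev k +oo%E Omega u & saturated C u].
Proof.
move=> su0; have [M [M0 _ HM]] := sobolevoo_bounded Omega_open su0.
have [C0 HC0] := H_bdd M.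
exists C0 => C CC0; pose X0 := jet k Omega u0.
pose eta0 := Num.min (2^-1) (C - C0).
have eta00 : 0 < eta0 by rewrite lt_min invr_gt0 ltr0n subr_gt0.
have e1 : eta0 <= 2^-1 by rewrite ge_min lexx.
have e2 : eta0 <= C - C0 by rewrite ge_min lexx orbT.
have pj0 x : perturbed_jet a0 X0 (fun=> 0) x = X0 x.
  rewrite /perturbed_jet (@smooth_jet_supported _ _ _ _ _ set0) ?addr0//.
  exact: closed0.
have adm0 : admissible a0 Omega H X0 M C (fun=> 0) eta0.
  split => //; first exact: test_function0.
    apply: filterS HM => x + Ox => /(_ Ox) XM; apply: (@le_trans _ _ C0); last by lra.
    by rewrite pj0; apply: HC0.
  apply: filterS HM => x + Ox i _ => /(_ Ox) XM; rewrite pj0.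
  apply: (le_trans (ler_coord_norm _ _)); apply: (le_trans XM).
  by rewrite (mulr2n eta0); lra.
have [Phi [eta [Q HQ]]] := iterate_raise n_gt0 H_unif H_coerc
  rational_ball_open rational_ball_neq0 adm0.
have aP m : admissible a0 Omega H X0 M C (Phi m) (eta m) by case: (HQ m).
have eh m : eta m.+1 <= eta m / 2 by case: (HQ m).
have cQ m : compact (Q m) by case: (HQ m).
have sQ m : (mu (Q m) <= (eta m)%:E)%E by case: (HQ m) => _ _ _ [].
have Qe m x : ~ Q m x -> Phi m.+1 x = Phi m x by case: (HQ m) => _ _ _ [_ +] _; apply.
have [st stE] := stop_step Q.
have jX0 : is_jet Omega u0 X0 := sobolev_is_jet su0.
have jl := u_lim_jet Omega_open H_coerc aP eh cQ sQ Qe jX0 stE.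
pose u := u_lim a0 Phi Q u0 st.
have su : sobolev k +oo%E Omega u.
  exact: (u_lim_sobolev Omega_open H_coerc aP eh cQ sQ Qe jX0 stE).
have juE := is_jet_unique Omega_open (sobolev_is_jet su) jl.
exists u; split => //.
  apply: (u_lim_boundary Omega_open H_coerc aP eh cQ sQ Qe jX0 stE) => //.
  by exists M.
split.
  have := jet_lim_energy aP eh cQ sQ Qe stE.
  by apply: filterS2 juE => x jx + Ox => /(_ Ox); rewrite (jx Ox).
move=> U oU U0 UO y yC HU.
have Cy : 0 < C - y by rewrite subr_gt0.
have [m0 Hm0] := eta_lt aP eh Cy.
have [m mm0 mU] := rational_ball_sub m0 oU U0.
have [_ _ _ _ /(_ (subset_trans mU UO)) [Qm HZ]] := HQ m.
have := jet_lim_persistent aP eh cQ sQ Qe stE HZ; apply.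
apply: filterS2 HU juE => x Hx jx Qx; have Ux : U x by apply: mU; exact: Qm.
rewrite -(jx (UO _ Ux)); apply: (le_trans (Hx Ux)).
by have := Hm0 _ mm0; lra.
Qed.

(** A nonempty open set is not compact: it has no point with largest first
    coordinate. *)
Lemma open_diff_compact (U K : set V) : open U -> U !=set0 -> compact K -> K `<=` U ->
  open (U `\` K) /\ U `\` K !=set0.
Proof.
move=> oU [x Ux] cK KU; split.
  by apply: openI => //; apply: closed_openC; exact: compact_closed.
apply: contrapT => U0; have UK : U `<=` K.
  by move=> y Uy; apply: contrapT => Ky; apply: U0; exists y.
pose i : 'I_n := Ordinal n_gt0.
have [c /[!inE] Kc cmax] : exists2 c, c \in K &
    forall t, t \in K -> (t ord0 i : R) <= c ord0 i.
  apply: (@EVT_max_rV R n (fun x => x ord0 i)) => //; first by exists x; exact: UK.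
  by apply: continuous_subspaceT; exact: coord_continuous.
have /nbhs_ballP [d /= d0 dU] : nbhs c U by apply: open_nbhs_nbhs; split => //; exact: KU.
pose z : V := c + (d / 2) *: delta_mx ord0 i.
have : K z.
  apply: UK; apply: dU; rewrite -ball_normE/= opprD addrA subrr add0r normrN.
  apply: (@le_lt_trans _ _ (d / 2)); last by rewrite ltr_pdivrMr// ltr_pMr// ltr1n.
  have d20 : 0 <= d / 2 by rewrite divr_ge0// ltW.
  apply: rV_norm_le => // l; rewrite !mxE normrM ger0_norm//.
  by rewrite normr_nat ler_piMr// lern1 leq_b1.
move=> Kz; have := cmax z (mem_set Kz).
by rewrite !mxE !eqxx mulr1 gerDl leNgt divr_gt0.
Qed.

(** A compactly supported variation leaves an open part of [U] untouched, where a
    saturated map already has maximal energy. *)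
Lemma saturated_AM_c C u : sobolev k +oo%E Omega u -> saturated C u ->
  AM_c H Omega u.
Proof.
move=> su [HC Hsat]; split; first exact: su.
move=> U oU UO phi [sphi [K [cK KU phi0]]].
apply: le_ereal_inf_tmp => y Hy.
have [U0|U0] := pselect (U !=set0); last first.
  apply: ereal_inf_lbound; apply: aeW => x Ux.
  by exfalso; apply: U0; exists x.
have [oW W0] := open_diff_compact oU U0 cK KU.
have WO : U `\` K `<=` Omega by move=> x [/UO].
apply: (@le_trans _ _ C%:E).
  apply: ereal_inf_lbound; apply: filterS HC => x Hx Ux.
  by rewrite lee_fin; apply: Hx; exact: UO.
have ju := sobolev_is_jet su.
have juphi : is_jet Omega (u \+ phi)%R (jet k Omega (u \+ phi)%R).
  apply: is_jet_jet => i; have [_ /(_ i) [g _ wg]] := sphi.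
  have [G wG] : exists G, is_weak_deriv Omega (tagged i).2 (comp_of phi (tagged i).1) G.
    apply: (weak_deriv_extend Omega_open oU UO cK KU _ wg) => x Kx.
    by rewrite /comp_of phi0// mxE.
  exists (fun x => jet k Omega u x ord0 (enum_rank i) + 1 * G x).
  have := is_weak_derivD 1 Omega_open (ju i) wG.
  by congr (is_weak_deriv _ _ _ _); apply/funext => x; rewrite /comp_of mul1r mxE.
have jE : {ae mu, forall x, (U `\` K) x -> jet k Omega (u \+ phi)%R x = jet k Omega u x}.
  apply: (is_jet_local Omega_open oW WO juphi ju); apply: aeW => x [_ Kx].
  by rewrite /= phi0// addr0.
rewrite leNgt; apply/negP => yC.
have [r rC yr] : exists2 r : R, r < C & forall t : R, (t%:E <= y)%E -> t <= r.
  case: y {Hy} yC => [r||] //; first by rewrite lte_fin => rC; exists r.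
  by move=> _; exists (C - 1); [rewrite gtrBl|move=> t; rewrite leNgt ltNyr].
apply: (Hsat _ oW W0 WO r rC).
apply: filterS2 Hy jE => x Hx jx Wx; rewrite -(jx Wx); apply: yr.
by apply: Hx; case: Wx.
Qed.

Lemma saturated_level_unique C C' u v : sobolev k +oo%E Omega u ->
  sobolev k +oo%E Omega v -> saturated C u -> saturated C' v -> Omega !=set0 ->
  ae_class Omega u = ae_class Omega v -> C' <= C.
Proof.
move=> su sv [HC _] [_ HC'] O0 uv; rewrite leNgt; apply/negP => CC'.
have : ae_class Omega v u by rewrite -uv; exact: aeW.
move=> uvE.
have jE := is_jet_local Omega_open Omega_open (@subset_refl _ _)
  (sobolev_is_jet su) (sobolev_is_jet sv) uvE.
apply: (HC' _ Omega_open O0 (@subset_refl _ _) C CC').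
by apply: filterS2 HC jE => x + jx Ox => /(_ Ox); rewrite (jx Ox).
Qed.

End saturated.

Theorem corollary1p7 (R : realType) (n N k : nat)
    (n_gt0 : (0 < n)%N) (N_gt0 : (0 < N)%N) (k_gt0 : (0 < k)%N)
    (Omega : set 'rV[R]_n) (Omega_open : open Omega)
    (Omega_bounded : bounded_set Omega) (Omega_neq0 : Omega !=set0)
    (H : 'rV[R]_n -> jet_space R n N k -> R)
    (H_ge0 : forall x X, Omega x -> 0 <= H x X)
    (H_cont : {within Omega `*` [set: jet_space R n N k],
                continuous (fun z => H z.1 z.2)})
    (H_0 : forall x, Omega x -> H x 0 = 0)
    (H_decr : exists c : R -> R -> R,
      [/\ {within `[0, 1] `*` `[0, +oo[,
             continuous (fun z : R * R => c z.1 z.2)},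
          (forall t r, 0 <= t <= 1 -> 0 <= r -> 0 <= c t r),
          (forall r, 0 <= r -> c 1 r = 0),
          (forall t, 0 <= t <= 1 -> c t 0 = 0) &
          (forall t r, 0 < t < 1 -> 0 < r -> 0 < c t r) /\
          (forall t X, 0 <= t <= 1 ->
             \forall x \ae lebesgue_rV R n, Omega x ->
               H x (t *: X) <= H x X - c t (jet_norm X))])
    (H_modulus : forall rho, 0 < rho -> exists omega : R -> R,
      [/\ {within `]0, +oo[, continuous omega},
          (forall r r', 0 < r -> r <= r' -> omega r <= omega r'),
          omega r @[r --> 0^'+] --> 0 &
          \forall x \ae lebesgue_rV R n, Omega x ->
            forall X X', jet_norm X <= rho -> jet_norm X' <= rho -> X != X' ->
              `|H x X - H x X'| <= omega (jet_norm (X - X'))])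
    (H_convex : forall x X, Omega x ->
      convex_function (same_lower_order X) (H x))
    (u0 : 'rV[R]_n -> 'rV[R]_N) (u0_sobolev : sobolev k +oo%E Omega u0) :
  infinite_set
    (ae_class Omega @` (sobolevoo_bc k Omega u0 `&` AM_c H Omega)).
Proof.
have mO := open_measurable_rV Omega_open.
pose a0 : 'I_N := Ordinal N_gt0.
have Ofin : (lebesgue_rV R n Omega < +oo)%E.
  have [M [_ /(_ (`|M| + 1))]] := Omega_bounded.
  rewrite (le_lt_trans (ler_norm M)) ?ltrDl// => /(_ isT) OM.
  have M0 : 0 <= `|M| + 1 by rewrite addr_ge0.
  apply: (@le_lt_trans _ _ (lebesgue_rV R n (cube 0 (`|M| + 1)))).
    apply: le_measure; rewrite ?inE//; first exact: measurable_cube.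
    by move=> x /OM; rewrite /cube/= subr0.
  by rewrite (lebesgue_cube _ M0) ltry.
have [Hmono [c0 c00 Hunit]] := H_scaling Omega_open H_ge0 H_cont H_decr.
have Hunif := H_unif_cont Omega_open H_cont H_modulus.
have Hcoerc := H_coercive Omega_open H_cont H_0 H_modulus Hmono c00 Hunit H_convex.
have Hbdd := H_bounded Omega_open H_ge0 H_cont H_0 H_modulus.
have [C0 HC0] := exists_saturated n_gt0 Omega_open Hunif Hcoerc Hbdd Ofin a0 u0_sobolev.
have /choice [u Hu] : forall j : nat, exists u,
    [/\ sobolevoo_bc k Omega u0 u, sobolev k +oo%E Omega u &
        saturated Omega H (C0 + j.+1%:R) u].
  by move=> j; apply: HC0; rewrite ltrDl ltr0n.
have inj : injective (fun j => ae_class Omega (u j)).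
  move=> i j uij; have [_ si Si] := Hu i; have [_ sj Sj] := Hu j.
  have := saturated_level_unique Omega_open si sj Si Sj Omega_neq0 uij.
  have := saturated_level_unique Omega_open sj si Sj Si Omega_neq0 (esym uij).
  rewrite !lerD2l !ler_nat !ltnS => ij ji.
  by apply/eqP; rewrite eqn_leq ij.
move=> fin; apply: infinite_nat.
have : finite_set ((fun j => ae_class Omega (u j)) @` [set: nat]).
  apply: sub_finite_set fin => _ [j _ <-].
  have [bj sj Sj] := Hu j.
  exists (u j); last by reflexivity.
  by split; [exact: bj|exact: (saturated_AM_c n_gt0 Omega_open sj Sj)].
by rewrite (eq_finite_set (inj_card_eq (in2W inj))).
Qed.
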